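(* For $\lambda\in -\frac{1}{2}+\mathbb{N}$, $c\in\mathbb{C}\setminus\{0\}$ and $x\in\mathbb{C}$ with $x\neq 0$ and $0\le \operatorname{Re}(x)<1$, let $B^{(q)}_x(N(\lambda,c))$ be the complex vector space with basis $\{v_{i,j}\}_{i,j\in\mathbb{Z},\,0\le j\le \lambda+\frac{1}{2}}$. Then setting $$q v_{i,j}=v_{i+1,j},$$ $$f v_{i,j}=\begin{cases} v_{i,j+1}, & \text{if } j<\lambda+\frac12,\\ -\sum_{s=0}^{\lambda+\frac12}\frac{1}{(2c)^{\lambda+\frac32-s}}\binom{\lambda+\frac32}{s}v_{i+2\lambda+3-2s,\,s}, & \text{if } j=\lambda+\frac12,\end{cases}$$ $$z v_{i,j}=c\,v_{i,j},$$ $$h v_{i,j}=(\lambda-(i+x)-2j)v_{i,j},$$ $$p v_{i,j}=-j\,v_{i+1,j-1}+c(i+x)v_{i-1,j},$$ $$e v_{i,j}=j(\lambda+1-(i+x)-j)v_{i,j-1}+\tfrac12 c(i+x)((i+x)-1)v_{i-2,j}$$ defines on $B^{(q)}_x(N(\lambda,c))$ the structure of a $U$-module. Moreover, every module in $\mathcal{N}$ is isomorphic to precisely one module of this form (that is, to $B^{(q)}_x(N(\lambda,c))$ for precisely one triple $(\lambda,c,x)$ with $\lambda\in -\frac{1}{2}+\mathbb{N}$, $c\in\mathbb{C}\setminus\{0\}$ and $x\in\mathbb{C}$ satisfying $x\neq 0$ and $0\le \operatorname{Re}(x)<1$).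
   Context: $\mathbb{N}$ denotes the set of nonnegative integers. The Schrödinger algebra $\mathcal{S}$ is the complex Lie algebra with basis $\{f,q,h,z,p,e\}$ and Lie bracket determined by $[h,e]=2e$, $[h,p]=p$, $[h,f]=-2f$, $[e,q]=p$, $[e,p]=0$, $[e,f]=h$, $[p,f]=-q$, $[f,q]=0$, $[h,q]=-q$, $[p,q]=z$, $[z,\mathcal{S}]=0$. $U$ is the universal enveloping algebra of $\mathcal{S}$. A weight module is a $U$-module that is a direct sum of simultaneous eigenspaces (weight spaces) of $h$ and $z$. On a simple weight module $z$ acts as a scalar, so weight spaces are the $h$-eigenspaces $V_\lambda$; $\operatorname{supp}(V)$ denotes the set of $h$-eigenvalues (weights). Weights are partially ordered by $\lambda_1\le\lambda_2$ iff $\lambda_2-\lambda_1\in\mathbb{N}$; a highest (lowest) weight is a maximal (minimal) element of $\operatorname{supp}(V)$. $\mathcal{N}$ denotes the class of simple weight $U$-modules with finite-dimensional weight spaces on which at least one of $p$, $q$ acts nonzero and which have neither a highest nor a lowest weight. In the formulas, terms $v_{i',-1}$ occur only with coefficient $0$ and are read as $0$. *)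

(* Defs.v *)
From HB Require Import structures.
From mathcomp Require Import all_boot all_order all_algebra.
From mathcomp Require Import finmap.
From mathcomp Require Import boolp reals complex.
From mathcomp Require Import monalg.

Set Implicit Arguments.
Unset Strict Implicit.
Unset Printing Implicit Defensive.

Import Order.TTheory GRing.Theory Num.Theory.
Local Open Scope ring_scope.

(* The complex numbers are [R[i]] for an arbitrary [R : realType].            *)

(* The two-sided ideal of [A] generated by the set [rel].                     *)
Inductive gen_ideal (K : nzRingType) (A : lalgType K) (rel : A -> Prop) :
    A -> Prop :=
| gen_ideal0 : gen_ideal rel 0
| gen_idealD (a r b w : A) :
    rel r -> gen_ideal rel w -> gen_ideal rel (a * r * b + w).

Section QuotientAlgebra.
Context (K : nzRingType) (A : lalgType K) (rel : A -> Prop).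
Implicit Types u w : A.

Definition ideal_pred : {pred A} := [pred w | `[< gen_ideal rel w >]].

Lemma ideal_predP w : reflect (gen_ideal rel w) (w \in ideal_pred).
Proof. exact: asboolP. Qed.

Lemma gen_ideal_add u w :
  gen_ideal rel u -> gen_ideal rel w -> gen_ideal rel (u + w).
Proof.
move=> Iu Iw; elim: Iu => [|a r b u' relr _ IHu]; first by rewrite add0r.
by rewrite -addrA; apply: gen_idealD.
Qed.

Lemma gen_ideal_mul (c d w : A) :
  gen_ideal rel w -> gen_ideal rel (c * w * d).
Proof.
elim=> [|a r b u relr _ IHu].
  by rewrite mulr0 mul0r; apply: gen_ideal0.
rewrite mulrDr mulrDl !mulrA -[_ * b * d]mulrA.
exact: gen_idealD.
Qed.

Lemma ideal_pred_zmod_closed : zmod_closed ideal_pred.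
Proof.
split=> [|u w /ideal_predP Iu /ideal_predP Iw].
  by apply/ideal_predP; apply: gen_ideal0.
apply/ideal_predP/gen_ideal_add => //.
by rewrite -[w]mulr1 -mulN1r mulrA; apply: gen_ideal_mul.
Qed.

HB.instance Definition _ :=
  GRing.isZmodClosed.Build A ideal_pred ideal_pred_zmod_closed.

(* The library makes quotients by ideals into rings only when the ring is     *)
(* commutative.                                                               *)
Definition quot_alg : Type := Quotient.quot ideal_pred.

HB.instance Definition _ := GRing.Zmodule.on quot_alg.

Definition qpi w : quot_alg := (\pi_(Quotient.quot ideal_pred) w)%qT.
Definition qrepr (x : quot_alg) : A := repr (x : Quotient.quot ideal_pred).

Lemma qreprK : cancel qrepr qpi.
Proof. exact: reprK. Qed.

Lemma qpiE u w : qpi u = qpi w <-> gen_ideal rel (u - w).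
Proof.
rewrite /qpi; split=> [/eqP | Iuw]; last apply/eqP.
  by rewrite -Quotient.idealrBE => /ideal_predP.
by rewrite -Quotient.idealrBE; apply/ideal_predP.
Qed.

Lemma qpiD : {morph qpi : u w / u + w}.
Proof. by move=> u w; rewrite /qpi raddfD. Qed.

Definition qone : quot_alg := qpi 1.
Definition qmul (x y : quot_alg) : quot_alg := qpi (qrepr x * qrepr y).
Definition qscale (a : K) (x : quot_alg) : quot_alg := qpi (a *: qrepr x).

Lemma qreprPi u : gen_ideal rel (qrepr (qpi u) - u).
Proof. by apply/qpiE; rewrite qreprK. Qed.

Lemma qpiM u w : qpi (u * w) = qmul (qpi u) (qpi w).
Proof.
apply/esym/qpiE; set u' := qrepr _; set w' := qrepr _.
have -> : u' * w' - u * w = 1 * (u' - u) * w' + u * (w' - w) * 1.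
  by rewrite mul1r mulr1 mulrBl mulrBr addrA subrK.
by apply: gen_ideal_add; apply: gen_ideal_mul; apply: qreprPi.
Qed.

Lemma qpiZ (a : K) u : qpi (a *: u) = qscale a (qpi u).
Proof.
apply/esym/qpiE; rewrite -scalerBr -[_ - _]mul1r scalerAl -[_ * _]mulr1.
by apply: gen_ideal_mul; apply: qreprPi.
Qed.

Lemma qmulA : associative qmul.
Proof.
by move=> x y z; rewrite -[x]qreprK -[y]qreprK -[z]qreprK -!qpiM mulrA.
Qed.

Lemma qmul1r : left_id qone qmul.
Proof. by move=> x; rewrite -[x]qreprK -qpiM mul1r. Qed.

Lemma qmulr1 : right_id qone qmul.
Proof. by move=> x; rewrite -[x]qreprK -qpiM mulr1. Qed.

Lemma qmulDl : left_distributive qmul +%R.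
Proof.
move=> x y z; rewrite -[x]qreprK -[y]qreprK -[z]qreprK.
by rewrite -qpiD -!qpiM mulrDl qpiD.
Qed.

Lemma qmulDr : right_distributive qmul +%R.
Proof.
move=> x y z; rewrite -[x]qreprK -[y]qreprK -[z]qreprK.
by rewrite -qpiD -!qpiM mulrDr qpiD.
Qed.

HB.instance Definition _ := GRing.Zmodule_isPzRing.Build quot_alg
  qmulA qmul1r qmulr1 qmulDl qmulDr.

Lemma qscaleA (a b : K) x : qscale a (qscale b x) = qscale (a * b) x.
Proof. by rewrite -[x]qreprK -!qpiZ scalerA. Qed.

Lemma qscale1 : left_id 1 qscale.
Proof. by move=> x; rewrite -[x]qreprK -qpiZ scale1r. Qed.

Lemma qscaleDr : right_distributive qscale +%R.
Proof.
move=> a x y; rewrite -[x]qreprK -[y]qreprK.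
by rewrite -qpiD -!qpiZ scalerDr qpiD.
Qed.

Lemma qscaleDl x : {morph qscale^~ x : a b / a + b}.
Proof. by move=> a b; rewrite /= -[x]qreprK -!qpiZ scalerDl qpiD. Qed.

HB.instance Definition _ := GRing.Zmodule_isLmodule.Build K quot_alg
  qscaleA qscale1 qscaleDr qscaleDl.

End QuotientAlgebra.

Inductive sgen : predArgType := Gf | Gq | Gh | Gz | Gp | Ge.

Definition sgen_code (g : sgen) : 'I_6 :=
  inord (match g with
         | Gf => 0 | Gq => 1 | Gh => 2 | Gz => 3 | Gp => 4 | Ge => 5
         end)%N.

Definition sgen_decode (k : 'I_6) : sgen := nth Gf [:: Gf; Gq; Gh; Gz; Gp; Ge] k.

Lemma sgen_codeK : cancel sgen_code sgen_decode.
Proof. by case; rewrite /sgen_decode /sgen_code inordK. Qed.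

HB.instance Definition _ := Finite.copy sgen (can_type sgen_codeK).

Definition schr (R : realType) : lmodType R[i] := {ffun sgen -> R[i]}.

Definition sbasis (R : realType) (g : sgen) : schr R :=
  [ffun g' => (g' == g)%:R].

Definition sbracket_gen (R : realType) (a b : sgen) : schr R :=
  match a, b with
  | Gh, Ge => 2 *: sbasis R Ge    | Ge, Gh => - (2 *: sbasis R Ge)
  | Gh, Gp => sbasis R Gp         | Gp, Gh => - sbasis R Gp
  | Gh, Gf => - (2 *: sbasis R Gf) | Gf, Gh => 2 *: sbasis R Gf
  | Gh, Gq => - sbasis R Gq       | Gq, Gh => sbasis R Gq
  | Ge, Gq => sbasis R Gp         | Gq, Ge => - sbasis R Gp
  | Ge, Gf => sbasis R Gh         | Gf, Ge => - sbasis R Gh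
  | Gp, Gf => - sbasis R Gq       | Gf, Gp => sbasis R Gq
  | Gp, Gq => sbasis R Gz         | Gq, Gp => - sbasis R Gz
  | _, _ => 0
  end.

Definition sbracket (R : realType) (s t : schr R) : schr R :=
  \sum_a \sum_b (s a * t b) *: sbracket_gen R a b.

(* The tensor algebra of [schr R], realised as the free associative algebra   *)
(* on the basis of [schr R].                                                  *)
Definition stens (R : realType) : lalgType R[i] := {malg R[i][{fmonom sgen}]}.

Definition stens_in (R : realType) (s : schr R) : stens R :=
  \sum_g s g *: (<< fmu g >> : {malg R[i][{fmonom sgen}]}).

Definition env_rel (R : realType) (w : stens R) : Prop :=
  exists x y : schr R,
    w = stens_in x * stens_in y - stens_in y * stens_in x
        - stens_in (sbracket x y).

Notation Uenv R := (quot_alg (@env_rel R)).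

Definition ugen (R : realType) (g : sgen) : Uenv R :=
  qpi (@env_rel R) (stens_in (sbasis R g)).

Definition is_umodule (R : realType) (V : lmodType R[i])
    (act : Uenv R -> V -> V) : Prop :=
  [/\ forall u, linear (act u),
      forall v, linear (act^~ v),
      forall v, act 1 v = v
    & forall u w v, act (u * w) v = act u (act w v)].

Definition is_usubmodule (R : realType) (V : lmodType R[i])
    (act : Uenv R -> V -> V) (W : V -> Prop) : Prop :=
  [/\ W 0,
      forall (a : R[i]) v w, W v -> W w -> W (a *: v + w)
    & forall u v, W v -> W (act u v)].

Definition is_simple (R : realType) (V : lmodType R[i])
    (act : Uenv R -> V -> V) : Prop :=
  (exists v : V, v != 0) /\
  forall W : V -> Prop, is_usubmodule act W ->
    (forall v, W v -> v = 0) \/ (forall v, W v).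

Definition in_eigenspace (R : realType) (V : lmodType R[i])
    (act : Uenv R -> V -> V) (g : sgen) (lam : R[i]) (v : V) : Prop :=
  act (ugen R g) v = lam *: v.

Definition is_weight (R : realType) (V : lmodType R[i])
    (act : Uenv R -> V -> V) : Prop :=
  forall v : V, exists! m : {fsfun R[i] * R[i] -> V with 0},
    (forall w, in_eigenspace act Gh w.1 (m w) /\
               in_eigenspace act Gz w.2 (m w)) /\
    v = \sum_(w <- finsupp m) m w.

(* On a simple weight module [z] acts as a scalar, so the weight spaces are    *)
(* the [h]-eigenspaces.                                                       *)
Definition in_supp (R : realType) (V : lmodType R[i])
    (act : Uenv R -> V -> V) (lam : R[i]) : Prop :=
  exists2 v : V, v != 0 & in_eigenspace act Gh lam v.

Definition weight_le (R : realType) (lam mu : R[i]) : Prop :=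
  exists k : nat, mu - lam = k%:R.

Definition is_highest_weight (R : realType) (V : lmodType R[i])
    (act : Uenv R -> V -> V) (lam : R[i]) : Prop :=
  in_supp act lam /\
  forall mu, in_supp act mu -> weight_le lam mu -> mu = lam.

Definition is_lowest_weight (R : realType) (V : lmodType R[i])
    (act : Uenv R -> V -> V) (lam : R[i]) : Prop :=
  in_supp act lam /\
  forall mu, in_supp act mu -> weight_le mu lam -> mu = lam.

Definition fin_dim (R : realType) (V : lmodType R[i]) (W : V -> Prop) : Prop :=
  exists (d : nat) (b : 'I_d -> V), (forall k, W (b k)) /\
    forall v, W v -> exists a : 'I_d -> R[i], v = \sum_k a k *: b k.

Definition in_classN (R : realType) (V : lmodType R[i])
    (act : Uenv R -> V -> V) : Prop :=
  is_simple act /\ is_weight act /\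
  (forall lam, fin_dim (in_eigenspace act Gh lam)) /\
  ((exists v, act (ugen R Gp) v <> 0) \/ (exists v, act (ugen R Gq) v <> 0)) /\
  ~ (exists lam, is_highest_weight act lam) /\
  ~ (exists lam, is_lowest_weight act lam).

Definition umodule_iso (R : realType) (V W : lmodType R[i])
    (actV : Uenv R -> V -> V) (actW : Uenv R -> W -> W) : Prop :=
  exists2 phi : {linear V -> W},
    bijective phi & forall u v, phi (actV u v) = actW u (phi v).

(* The space with basis [v_(i, j)], [i : int], [0 <= j <= n], where           *)
(* [n = lambda + 1/2].                                                        *)
Definition Bspace (R : realType) (n : nat) : lmodType R[i] :=
  {malg R[i][(int * 'I_n.+1)%type]}.

(* Only meaningful for [j <= n].                                              *)
Definition Bvec (R : realType) (n : nat) (i : int) (j : nat) : Bspace R n :=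
  (<< (i, inord j : 'I_n.+1) >> : {malg R[i][(int * 'I_n.+1)%type]}).

(* For [j = 0] the terms in [Bvec _ _ i j.-1] have coefficient [0].           *)
Definition Bq_formulas (R : realType) (n : nat) (lam c x : R[i])
    (act : Uenv R -> Bspace R n -> Bspace R n) : Prop :=
  forall (i : int) (j : nat), (j <= n)%N ->
    let v := @Bvec R n in
    let y : R[i] := i%:~R + x in
    act (ugen R Gq) (v i j) = v (i + 1) j /\
    act (ugen R Gf) (v i j) =
      (if (j < n)%N then v i j.+1
       else - \sum_(0 <= s < n.+1)
                ((2 * c) ^- (n.+1 - s) * 'C(n.+1, s)%:R)
                  *: v (i + 2 * (n.+1)%:Z - 2 * s%:Z) s) /\
    act (ugen R Gz) (v i j) = c *: v i j /\
    act (ugen R Gh) (v i j) = (lam - y - 2 * j%:R) *: v i j /\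
    act (ugen R Gp) (v i j) =
      - (j%:R *: v (i + 1) j.-1) + (c * y) *: v (i - 1) j /\
    act (ugen R Ge) (v i j) =
      (j%:R * (lam + 1 - y - j%:R)) *: v i j.-1
      + (2^-1 * c * y * (y - 1)) *: v (i - 2) j.

Definition Bq_params (R : realType) (n : nat) (lam c x : R[i]) : Prop :=
  [/\ lam = n%:R - 2^-1, c != 0, x != 0 & 0 <= complex.Re x < 1].

(* Main.v *)
Require Import Defs.
From HB Require Import structures.
From mathcomp Require Import all_boot all_order all_algebra.
From mathcomp Require Import finmap ring zify.
From mathcomp Require Import boolp reals complex.
From mathcomp Require Import monalg.

(** Write [a = 1 / (2 c)].  When [z] acts by a scalar [c != 0], the operators
    [F = f + a q^2], [E = e - a p^2] and [H = h + q p / c + 1/2] satisfy the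
    relations of sl2 and commute with [q] and [p], which satisfy the Weyl
    relation.  Both halves of the theorem rest on this splitting of the
    enveloping algebra into a Weyl algebra and the enveloping algebra of sl2.

    The formulas define a module because they describe a tensor product in an
    adapted basis.  Let [q] shift [w_(i, j)] to [w_(i + 1, j)], let [q p] act on
    it by [c (i + x)], and let [F], [E], [H] act on the index [j] as on the
    simple sl2-module of dimension [n + 1], where [n = lambda + 1/2]; the
    relations are then immediate ([tensor_rep]).  In the basis
    [v_(i, j) = f ^ j w_(i, 0)] the operators take the prescribed form, the
    formula for [f v_(i, n)] being the binomial expansion of
    [(f + a q^2) ^ (n + 1) v_(i, 0) = 0] ([standard_rep]).

    Let [V] be in the class, with [z] acting by [c] ([central_scalar]).  If [q]
    had a kernel it would be locally nilpotent, so its kernel would meet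
    arbitrarily low weights, and raising these vectors back to a fixed weight
    would give vectors of unbounded [q]-nilpotency order in a finite-dimensional
    space; the same holds for [p] by symmetry, and the one case that escapes,
    [c = 0] with both kernels nonzero, makes [p] and [q] vanish
    ([kernel_q_degenerate], [injective_qp]).  So [q] and [p] are injective.
    Then [c != 0], since otherwise [q^-2 f] and [q p] would realise the
    Heisenberg relation in finite dimension ([central_charge_neq0]).  A
    finite-dimensional weight space now contains a highest-weight vector for
    [E], [F], [H], of some weight [n] ([sl2_highest_vector]); moving it by [q]
    and [p] yields a family [v_i] with all the properties of the [v_(i, 0)]
    ([seed_exists]), and [v_(i, j) |-> f ^ j v_i] is the isomorphism wanted.  It
    is injective because the vectors [F ^ j v_i] are eigenvectors of a
    combination of [q p] and [H] with distinct eigenvalues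
    ([family_map_injective]), and surjective because [V] is simple
    ([realization_iso]).

    The parameters are invariants: [c] is the action of [z], [n] is the last
    exponent with [F ^ n != 0], and [x] is determined modulo the integers, hence
    exactly, by the weights ([standard_iso_invariants]). *)

Set Implicit Arguments.
Unset Strict Implicit.
Unset Printing Implicit Defensive.

Import Order.TTheory GRing.Theory Num.Theory.
Local Open Scope ring_scope.

(** * Deciding linear combinations *)

Section LinearCombinations.
Context (K : comNzRingType) (V : lmodType K).

Inductive lexpr : Type :=
| LZero | LAtom of nat | LAdd of lexpr & lexpr | LOpp of lexpr
| LScale of K & lexpr.

Fixpoint leval (env : seq V) (t : lexpr) : V :=
  match t with
  | LZero => 0
  | LAtom k => nth 0 env k
  | LAdd t u => leval env t + leval env u
  | LOpp t => - leval env t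
  | LScale a t => a *: leval env t
  end.

Fixpoint lcoef (k : nat) (t : lexpr) : K :=
  match t with
  | LZero => 0
  | LAtom j => if Nat.eqb j k then 1 else 0
  | LAdd t u => lcoef k t + lcoef k u
  | LOpp t => - lcoef k t
  | LScale a t => a * lcoef k t
  end.

(** A conjunction, so that each coefficient becomes a separate goal. *)
Fixpoint lequal (n : nat) (t u : lexpr) : Prop :=
  if n is m.+1 then lcoef m t = lcoef m u /\ lequal m t u else True.

Lemma levalE env t :
  leval env t = \sum_(k < size env) lcoef k t *: env`_k.
Proof.
elim: t => [|j|t IHt u IHu|t IHt|a t IHt] /=.
- by rewrite big1 // => k _; rewrite scale0r.
- have eqbE k : Nat.eqb j k = (j == k) by apply/PeanoNat.Nat.eqb_spec/eqP.
  have [ltj|lej] := ltnP j (size env).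
    rewrite (bigD1 (Ordinal ltj)) //= eqbE eqxx scale1r big1 ?addr0 // => k nek.
    by rewrite eqbE (_ : j == k = false) ?scale0r // eq_sym; apply: negbTE nek.
  rewrite nth_default // big1 // => k _.
  by rewrite eqbE gtn_eqF ?scale0r // (leq_trans (ltn_ord k)).
- by rewrite IHt IHu -big_split; apply: eq_bigr => k _; rewrite scalerDl.
- by rewrite IHt -sumrN; apply: eq_bigr => k _; rewrite scaleNr.
- by rewrite IHt scaler_sumr; apply: eq_bigr => k _; rewrite scalerA.
Qed.

(** Two linear combinations of the same vectors agree as soon as their
    coefficients do; comparing coefficients turns identities between vectors
    into scalar identities, which [ring] decides. *)
Lemma leval_eq env t u : lequal (size env) t u -> leval env t = leval env u.
Proof.
rewrite !levalE; elim: (size env) => [|n IHn] /=; first by rewrite !big_ord0.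
by case=> eq_n /IHn eq_sum; rewrite !big_ord_recr /= eq_sum eq_n.
Qed.

End LinearCombinations.

(** Atoms are compared up to conversion: one and the same operator may be applied
    through different canonical structures. *)
Ltac atom_index v env :=
  match env with
  | ?w :: _ => let _ := constr:(erefl : w = v) in constr:(0%N)
  | _ :: ?env' => let k := atom_index v env' in constr:(k.+1)
  end.

Ltac add_atom v env :=
  match env with
  | _ => let k := atom_index v env in env
  | _ => constr:(v :: env)
  end.

Ltac collect_atoms t env :=
  lazymatch t with
  | (?a + ?b)%R => let env' := collect_atoms a env in collect_atoms b env'
  | (- ?a)%R => collect_atoms a env
  | (_ *: ?a)%R => collect_atoms a env
  | 0%R => env
  | _ => add_atom t env
  end.

Ltac reify_lexpr K t env :=
  lazymatch t with
  | (?a + ?b)%R =>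
      let a' := reify_lexpr K a env in let b' := reify_lexpr K b env in
      constr:(@LAdd K a' b')
  | (- ?a)%R => let a' := reify_lexpr K a env in constr:(@LOpp K a')
  | (?c *: ?a)%R => let a' := reify_lexpr K a env in constr:(@LScale K c a')
  | 0%R => constr:(@LZero K)
  | _ => let k := atom_index t env in constr:(@LAtom K k)
  end.

Ltac compare_coefficients K V :=
  lazymatch goal with
  | |- ?x = ?y =>
      let env0 := constr:(@nil (GRing.Lmodule.sort V)) in
      let env1 := collect_atoms x env0 in
      let env := collect_atoms y env1 in
      let t := reify_lexpr K x env in
      let u := reify_lexpr K y env in
      refine (@leval_eq K V env t u _);
      cbn [size lequal lcoef Nat.eqb]; repeat split
  end.

(** * Iterates of linear operators *)

Section LinearMaps.
Context (K : nzRingType) (V W : lmodType K) (g : {linear V -> W}).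

(** These name the map [g]; left to unification, the generic lemmas may take an
    opposite or a scaling for the linear map. *)
Lemma linD u v : g (u + v) = g u + g v. Proof. exact: linearD. Qed.
Lemma linN v : g (- v) = - g v. Proof. exact: linearN. Qed.
Lemma linZ a v : g (a *: v) = a *: g v. Proof. exact: linearZ_LR. Qed.

Definition linear_opsE := (linear0 g, linD, linN, linZ).

End LinearMaps.

Section Iterates.
Context (K : nzRingType) (V : lmodType K).
Implicit Types (A B Z : {linear V -> V}) (v : V).

Lemma iter_is_linear A k : linear (iter k A).
Proof. by elim: k => //= k IHk a v w /=; rewrite IHk linearP. Qed.

HB.instance Definition _ A k :=
  GRing.isLinear.Build K V V *:%R (iter k A) (iter_is_linear A k).

Lemma iterZ A k a v : iter k A (a *: v) = a *: iter k A v.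
Proof. exact: linZ. Qed.

Lemma iter_comm (T : Type) (f g : T -> T) k x :
  (forall y, f (g y) = g (f y)) -> f (iter k g x) = iter k g (f x).
Proof. by move=> fg; elim: k => //= k <-. Qed.

Lemma iter_commutator A B Z k v :
  (forall v, A (B v) = B (A v) + Z v) -> (forall v, Z (B v) = B (Z v)) ->
  A (iter k.+1 B v) = iter k.+1 B (A v) + k.+1%:R *: iter k B (Z v).
Proof.
move=> AB ZB; elim: k => [|k IHk]; first by rewrite /= AB scale1r.
rewrite iterS AB IHk linearD linearZ_LR -addrA (iter_comm _ _ ZB).
by rewrite -[k.+2%:R]natr1 scalerDl scale1r.
Qed.

(** [A] lowers the powers of [B] like a derivative, so that [k] applications
    reduce [B ^ k v] to a multiple of [Z ^ k v] and one more kills it. *)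
Lemma iter_lowering A B Z k v :
  (forall v, A (B v) = B (A v) + Z v) ->
  (forall v, Z (B v) = B (Z v)) -> (forall v, Z (A v) = A (Z v)) -> A v = 0 ->
  iter k A (iter k B v) = k`!%:R *: iter k Z v /\ iter k.+1 A (iter k B v) = 0.
Proof.
move=> AB ZB ZA; elim: k v => [|k IHk] v Av0; first by rewrite /= scale1r.
have AZ : A (Z v) = 0 by rewrite -ZA Av0 linear0.
have ABk : A (iter k.+1 B v) = k.+1%:R *: iter k B (Z v).
  by rewrite (iter_commutator _ _ AB ZB) Av0 linear0 add0r.
rewrite [iter k.+1 A _]iterSr [iter k.+2 A _]iterSr ABk !iterZ.
have [-> ->] := IHk _ AZ; rewrite scaler0 scalerA -natrM -factS.
by rewrite -iterSr.
Qed.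

Lemma last_nonzero_iterate A k v : v != 0 -> iter k A v = 0 ->
  exists2 j, iter j A v != 0 & A (iter j A v) = 0.
Proof.
move=> v_neq0; elim: k => [|k IHk] /=; first by move/eqP; rewrite (negPf v_neq0).
have [/IHk//|] := eqVneq (iter k A v) 0; by exists k.
Qed.

Lemma iter_weight A B (a b : K) k v :
  (forall v, A (B v) = B (A v) + b *: B v) -> A v = a *: v ->
  A (iter k B v) = (a + k%:R * b) *: iter k B v.
Proof.
move=> AB Av; elim: k => [|k IHk] /=; first by rewrite mul0r addr0.
rewrite AB IHk linearZ /= -scalerDl -addrA; congr ((_ + _) *: _).
by rewrite -natr1 mulrDl mul1r.
Qed.

End Iterates.

(** * Finite-dimensional subspaces *)

Section FiniteDimension.
Context (K : numClosedFieldType) (V : lmodType K).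
Implicit Types (u v w : V) (W : V -> Prop).

Definition subspace W : Prop :=
  W 0 /\ forall (a : K) v w, W v -> W w -> W (a *: v + w).

Definition finite_span W : Prop :=
  exists (d : nat) (b : 'I_d -> V), (forall k, W (b k)) /\
    forall v, W v -> exists a : 'I_d -> K, v = \sum_k a k *: b k.

Lemma subspaceD W v w : subspace W -> W v -> W w -> W (v + w).
Proof. by case=> _ WD Wv Ww; rewrite -[v]scale1r; apply: WD. Qed.

Lemma subspaceZ W a v : subspace W -> W v -> W (a *: v).
Proof. by case=> W0 WD Wv; rewrite -[_ *: _]addr0; apply: WD. Qed.

Lemma subspaceB W v w : subspace W -> W v -> W w -> W (v - w).
Proof.
by move=> sW Wv Ww; apply: subspaceD => //; rewrite -scaleN1r; apply: subspaceZ.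
Qed.

Lemma subspace_sum W (I : Type) (r : seq I) (P : pred I) (F : I -> V) :
  subspace W -> (forall i, P i -> W (F i)) -> W (\sum_(i <- r | P i) F i).
Proof.
move=> sW WF; elim/big_rec: _ => [|i v Pi Wv]; first by case: sW.
by apply: subspaceD => //; apply: WF.
Qed.

Lemma subspace_iter W (T : V -> V) k v :
  (forall v, W v -> W (T v)) -> W v -> W (iter k T v).
Proof. by move=> WT Wv; elim: k => //= k; apply: WT. Qed.

Lemma subspace_eq0 : subspace (fun v => v = 0).
Proof. by split=> // a v w -> ->; rewrite scaler0 addr0. Qed.

Lemma subspace_eigen (D : {linear V -> V}) lam :
  subspace (fun v => D v = lam *: v).
Proof.
split=> [|a v w Dv Dw]; first by rewrite linear0 scaler0.
by rewrite linearP Dv Dw scalerDr !scalerA mulrC.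
Qed.

(** Subtracting the first eigenvalue from [D] removes the first term and
    rescales the others by nonzero factors. *)
Lemma eigen_components W (D : {linear V -> V}) (I : eqType) (r : seq I)
    (u : I -> V) (lam : I -> K) :
  subspace W -> (forall v, W v -> W (D v)) ->
  uniq r -> {in r &, injective lam} ->
  (forall k, k \in r -> D (u k) = lam k *: u k) ->
  W (\sum_(k <- r) u k) -> forall k, k \in r -> W (u k).
Proof.
move=> sW WD; elim: r u => [|k0 r IHr] u //= /andP[k0r uniqr] injlam Du.
rewrite big_cons => Wu.
have injr : {in r &, injective lam}.
  by move=> i j ri rj; apply: injlam; rewrite inE ?ri ?rj orbT.
have Wr k : k \in r -> W (u k).
  move=> rk; have ne : lam k - lam k0 != 0.
    rewrite subr_eq0; apply: contra k0r => /eqP eqlam.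
    by rewrite -(injlam k k0) // inE ?eqxx ?rk ?orbT.
  suff Wk : W ((lam k - lam k0) *: u k).
    by rewrite -(scalerK ne (u k)); apply: subspaceZ.
  apply: (IHr (fun j => (lam j - lam k0) *: u j)) => // [j rj|].
    by rewrite linearZ /= Du ?inE ?rj ?orbT // !scalerA mulrC.
  have -> : \sum_(j <- r) (lam j - lam k0) *: u j
            = D (u k0 + \sum_(j <- r) u j)
              - lam k0 *: (u k0 + \sum_(j <- r) u j).
    rewrite linearD linear_sum Du ?inE ?eqxx // scalerDr opprD addrACA subrr.
    rewrite add0r scaler_sumr -sumrB big_seq [RHS]big_seq; apply: eq_bigr => j rj.
    by rewrite Du ?inE ?rj ?orbT // scalerBl.
  by apply: subspaceB => //; [apply: WD | apply: subspaceZ].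
move=> k; rewrite inE => /predU1P[-> | /Wr//].
rewrite -(addrK (\sum_(j <- r) u j) (u k0)); apply: subspaceB => //.
by rewrite big_seq; apply: subspace_sum.
Qed.

(** Encoding the relation as a polynomial lets it be factored, and makes its last
    nonzero coefficient available. *)
Lemma finite_span_dependence W : finite_span W ->
  exists d, forall u : nat -> V, (forall k, W (u k)) ->
    exists a : {poly K}, [/\ a != 0, (size a <= d)%N
      & \sum_(k < d) a`_k *: u k = 0].
Proof.
case=> d [b [Wb Wspan]]; exists d.+1 => u Wu.
have [A uA] := choice (fun k : 'I_d.+1 => Wspan _ (Wu k)).
pose M := \matrix_(i < d.+1, j < d) A i j.
have kerM : kermx M != 0.
  by rewrite kermx_eq0 -row_leq_rank -ltnNge (leq_ltn_trans (rank_leq_col M)).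
have [i kerMi] : exists i, row i (kermx M) != 0.
  apply/existsP; apply: contraNT kerM; rewrite negb_exists => /forallP rows0.
  by apply/eqP/row_matrixP=> i; rewrite row0; apply/eqP; rewrite -[_ == _]negbK.
set a := row i _ in kerMi.
have aM0 : a *m M = 0 by rewrite -row_mul mulmx_ker row0.
have cE (k : 'I_d.+1) : (\poly_(k < d.+1) a 0 (inord k))`_k = a 0 k.
  by rewrite coef_poly ltn_ord inord_val.
exists (\poly_(k < d.+1) a 0 (inord k)); split; last 1 first.
- under eq_bigr do rewrite cE uA scaler_sumr.
  rewrite exchange_big big1 //= => j _.
  under eq_bigr do rewrite scalerA.
  rewrite -scaler_suml.
  have -> : \sum_k a 0 k * A k j = (a *m M) 0 j.
    by rewrite mxE; apply: eq_bigr => k _; rewrite [M _ _]mxE.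
  by rewrite aM0 mxE scale0r.
- apply: contra kerMi => /eqP p0; apply/eqP/rowP => k.
  by rewrite -cE p0 coef0 mxE.
- exact: size_poly.
Qed.

Let peval d (T : {linear V -> V}) (w : V) (P : {poly K}) : V :=
  \sum_(k < d) P`_k *: iter k T w.

(** Divide an annihilating polynomial by its linear factors one at a time; the
    last nonzero vector met on the way is an eigenvector. *)
Lemma finite_span_eigenvector W (T : {linear V -> V}) w :
  subspace W -> finite_span W -> (forall v, W v -> W (T v)) -> W w -> w != 0 ->
  exists u a, [/\ W u, u != 0 & T u = a *: u].
Proof.
move=> sW fW WT Ww w_neq0.
have [d dep] := finite_span_dependence fW.
have [P [P0 szP Pw0]] : exists P : {poly K},
    [/\ P != 0, (size P <= d)%N & peval d T w P = 0].
  by apply: dep => k; apply: subspace_iter.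
elim: {P}(size P) {-2}P (leqnn (size P)) P0 szP Pw0 => [|s IHs] P.
  by rewrite leqn0 size_poly_eq0 => /eqP->; rewrite eqxx.
move=> leP P0 szP Pw0.
have szP1 : size P != 1%N.
  apply: contraNneq w_neq0 => /eqP/size_poly1P[c c0 Pc].
  move: Pw0 szP; rewrite /peval Pc size_polyC c0; case: d {dep IHs} => // d.
  rewrite big_ord_recl coefC /= big1 => [|k _].
    by rewrite addr0 => /eqP; rewrite scaler_eq0 (negPf c0).
  by rewrite coefC scale0r.
have [r /factor_theorem[Q PQ]] := closed_rootP P szP1.
have Q0 : Q != 0 by apply: contraNneq P0 => Q0; rewrite PQ Q0 mul0r.
have szPQ : size P = (size Q).+1 by rewrite PQ size_Mmonic ?monicXsubC ?size_XsubC ?addn2.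
have evP : peval d T w P = T (peval d T w Q) - r *: peval d T w Q.
  case: d szP {dep Pw0 IHs} => [|d]; first by rewrite szPQ.
  rewrite szPQ ltnS => szQ; rewrite /peval PQ mulrBr.
  under eq_bigr do rewrite coefB coefMC scalerBl.
  rewrite sumrB; congr (_ - _); last first.
    by rewrite scaler_sumr; apply: eq_bigr => k _; rewrite scalerA mulrC.
  rewrite big_ord_recl coefMX scale0r add0r linear_sum big_ord_recr /=.
  rewrite (nth_default 0 szQ) scale0r linear0 addr0; apply: eq_bigr => k _.
  by rewrite coefMX linearZ.
have [Qw0|Qw_neq0] := eqVneq (peval d T w Q) 0.
  by apply: (IHs Q) => //; [rewrite -ltnS -szPQ | rewrite ltnW // -szPQ].
exists (peval d T w Q), r; split=> //.
  by apply: subspace_sum => // k _; apply: subspaceZ => //; apply: subspace_iter.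
by apply/eqP; rewrite -subr_eq0 -evP Pw0.
Qed.

(** The highest power occurring in a linear relation between the [u k] isolates
    the last of them. *)
Lemma nilpotency_bounded W (A : {linear V -> V}) : finite_span W ->
  exists N, forall u o, W u -> (N <= o)%N -> iter o.+1 A u = 0 ->
    iter o A u = 0.
Proof.
move=> fW; apply/not_existsP => unbounded.
have far N : exists uo : V * nat, [/\ W uo.1, (N <= uo.2)%N,
    iter uo.2.+1 A uo.1 = 0 & iter uo.2 A uo.1 != 0].
  have /existsNP[u /existsNP[o]] := unbounded N.
  move=> /not_implyP[Wu /not_implyP[No /not_implyP[Au0 /eqP Au]]].
  by exists (u, o).
have [g gP] := choice far.
(* Each order exceeds the previous one, which keeps the family independent. *)
pose G := fix G k := if k is k'.+1 then g (G k').2.+1 else g 0%N.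
have GP k : [/\ W (G k).1, iter (G k).2.+1 A (G k).1 = 0
    & iter (G k).2 A (G k).1 != 0] by case: k => [|k]; [case: (gP 0%N) | case: (gP (G k).2.+1)].
have Gmono i j : (i < j)%N -> ((G i).2 < (G j).2)%N.
  elim: j => // j IHj; rewrite ltnS leq_eqVlt => /predU1P[->|/IHj ltij] /=.
    by case: (gP (G j).2.+1).
  by apply: (ltn_trans ltij); case: (gP (G j).2.+1).
have [d dep] := finite_span_dependence fW.
have [|a [a0 sza rel]] := dep (fun k => (G k).1); first by move=> k; case: (GP k).
have szlt : ((size a).-1 < d)%N.
  by rewrite -ltnS prednK ?size_poly_gt0 //.
have := congr1 (iter (G (size a).-1).2 A) rel; rewrite linear0 linear_sum.
rewrite (bigD1 (Ordinal szlt)) //= big1 => [|k nek].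
  rewrite addr0 linearZ => /eqP; rewrite scaler_eq0 -lead_coefE.
  by rewrite lead_coef_eq0 (negPf a0) /=; case: (GP (size a).-1) => _ _ /negPf->.
have [ltk|gtk|eqk] := ltngtP k (size a).-1; last first.
- by rewrite -val_eqE /= eqk eqxx in nek.
- by rewrite nth_default ?scale0r ?linear0 // -(prednK (n := size a)) ?size_poly_gt0.
have /subnK <- := Gmono _ _ ltk; rewrite linearZ /= iterD.
by case: (GP k) => _ -> _; rewrite linear0 scaler0.
Qed.

(** Nonzero eigenvectors with distinct eigenvalues would be linearly
    independent. *)
Lemma eigen_string_breaks W (D : {linear V -> V}) (u : nat -> V)
    (lam : nat -> K) :
  finite_span W -> (forall k, W (u k)) -> injective lam ->
  (forall k, D (u k) = lam k *: u k) -> exists k, u k = 0.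
Proof.
move=> /finite_span_dependence[d dep] Wu injlam Du.
have [a [a0 sza rel]] := dep u Wu.
have szlt : ((size a).-1 < d)%N by rewrite -ltnS prednK ?size_poly_gt0.
exists (size a).-1.
have : a`_(size a).-1 *: u (size a).-1 = 0.
  apply: (@eigen_components (fun v => v = 0) D _ (index_iota 0 d)
            (fun k => a`_k *: u k) lam) => //.
  - exact: subspace_eq0.
  - by move=> v ->; rewrite linear0.
  - exact: iota_uniq.
  - by move=> i j _ _; apply: injlam.
  - by move=> k _; rewrite linearZ /= Du !scalerA mulrC.
  - by rewrite big_mkord.
  - by rewrite mem_index_iota.
move/eqP; rewrite scaler_eq0 -lead_coefE lead_coef_eq0 (negPf a0) /=.
by move/eqP.
Qed.

End FiniteDimension.

(** * Representations with a scalar central element *)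

Section Representations.
Context (K : numClosedFieldType) (V : lmodType K).

(** The brackets of the Schroedinger algebra for operators, [z] acting by the
    scalar [c]. *)
Record schr_rep (c : K) (q p f e h : {linear V -> V}) : Prop := SchrRep {
  rep_he v : h (e v) = e (h v) + 2 *: e v;
  rep_hp v : h (p v) = p (h v) + p v;
  rep_hf v : h (f v) = f (h v) - 2 *: f v;
  rep_hq v : h (q v) = q (h v) - q v;
  rep_eq v : e (q v) = q (e v) + p v;
  rep_ep v : e (p v) = p (e v);
  rep_ef v : e (f v) = f (e v) + h v;
  rep_pf v : p (f v) = f (p v) - q v;
  rep_fq v : f (q v) = q (f v);
  rep_pq v : p (q v) = q (p v) + c *: v
}.

(** The involution exchanging [q] with [p], [f] with [e], and negating [h] and
    [z], exchanges the highest and the lowest weights. *)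
Lemma schr_rep_swap c q p f e h :
  schr_rep c q p f e h -> schr_rep (- c) p q e f (\- h).
Proof.
case=> he hp hf hq eq ep ef pf fq pq.
split=> v /=; rewrite ?(he, hp, hf, hq, eq, ep, ef, pf, fq, pq) ?linearN /=;
  compare_coefficients K V; ring.
Qed.

Definition irreducible (q p f e h : {linear V -> V}) : Prop :=
  forall W : V -> Prop, subspace W ->
    (forall v, W v -> [/\ W (q v), W (p v), W (f v), W (e v) & W (h v)]) ->
    (forall v, W v -> v = 0) \/ (forall v, W v).

(** Finiteness of the weight multiplicities is included, so that for [\- h] the
    same record says that [h] has no highest weight. *)
Record no_lowest_weight (h : {linear V -> V}) : Prop := NoLowestWeight {
  weight_finite m : finite_span (fun v => h v = m *: v);
  weight_below (m : K) (v : V) : v != 0 -> h v = m *: v ->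
    exists (k : nat) (w : V), w != 0 /\ h w = (m - k.+1%:R) *: w
}.

Section Representation.
Context (c : K) (q p f e h : {linear V -> V}).
Hypothesis rep : schr_rep c q p f e h.

Lemma weight_q k m v : h v = m *: v -> h (iter k q v) = (m - k%:R) *: iter k q v.
Proof.
move=> hv; rewrite (iter_weight k (b := -1) _ hv) ?mulrN1 // => w.
by rewrite (rep_hq rep) scaleN1r.
Qed.

Lemma weight_p k m v : h v = m *: v -> h (iter k p v) = (m + k%:R) *: iter k p v.
Proof.
move=> hv; rewrite (iter_weight k (b := 1) _ hv) ?mulr1 // => w.
by rewrite (rep_hp rep) scale1r.
Qed.

Lemma weight_e k m v :
  h v = m *: v -> h (iter k e v) = (m + k%:R * 2) *: iter k e v.
Proof. by move=> hv; apply: iter_weight => // w; apply: rep_he rep _. Qed.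

Lemma weight_f k m v :
  h v = m *: v -> h (iter k f v) = (m - k%:R * 2) *: iter k f v.
Proof.
move=> hv; rewrite -mulrN; apply: iter_weight => // w.
by rewrite (rep_hf rep) scaleNr.
Qed.

Lemma iter_injective (A : {linear V -> V}) k (v : V) :
  (forall v, A v = 0 -> v = 0) -> v != 0 -> iter k A v != 0.
Proof.
move=> injA v0; elim: k => //= k; apply: contra => /eqP/injA->; exact: eqxx.
Qed.

(** The vectors killed by a power of [q] form a submodule, because bracketing
    with [q] sends [e] to [p], [p] to [z], and the rest to multiples of [q]. *)
Lemma locally_nilpotent_q (v0 : V) : irreducible q p f e h -> v0 != 0 -> q v0 = 0 ->
  forall v, exists k, iter k q v = 0.
Proof.
move=> irr v0_neq0 qv0; pose W v := exists k, iter k q v = 0.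
have sW : subspace W.
  split=> [|a v w [k vk] [l wl]]; first by exists 0%N.
  exists (k + l)%N; rewrite linearP /= {1}addnC !iterD vk wl.
  by rewrite !linear0 ?scaler0 addr0.
have Wq v : W v -> W (q v).
  by case=> k vk; exists k; rewrite -iter_comm // vk linear0.
(* By induction on [k]: if [q ^ k (q v) = 0], then both [g (q v)] and the
   commutator lie in [W], hence so do [q (g v)] and [g v]. *)
have Wstab (g : {linear V -> V}) :
    (forall v, W v -> W (q (g v) - g (q v))) -> forall v, W v -> W (g v).
  move=> Wg v [k]; elim: k v => [|k IHk] v; first by move=> /= ->; rewrite linear0; exists 0%N.
  rewrite iterSr => qvk; have Wv : W v by exists k.+1; rewrite iterSr.
  have := subspaceD sW (Wg _ Wv) (IHk _ qvk); rewrite subrK => -[l gl].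
  by exists l.+1; rewrite iterSr.
have Wp : forall v, W v -> W (p v).
  apply: Wstab => v Wv; rewrite (rep_pq rep) opprD addrA subrr sub0r -scaleNr.
  exact: subspaceZ.
case: (irr W sW) => [v Wv|W0|//].
- split; [exact: Wq | exact: Wp | apply: Wstab | apply: Wstab | apply: Wstab] => //.
  + by move=> w _; rewrite (rep_fq rep) subrr; exists 0%N.
  + move=> w Ww; rewrite (rep_eq rep) opprD addrA subrr sub0r -scaleN1r.
    by apply: subspaceZ => //; apply: Wp.
  + by move=> w Ww; rewrite (rep_hq rep) opprB addrA addrAC subrr add0r; apply: Wq.
- by case/eqP: v0_neq0; apply: W0; exists 1%N.
Qed.

(** A locally nilpotent [q] would have kernel vectors [v] in arbitrarily low
    weights [m - k].  Raising them back to weight [m], by [p ^ k] if [c != 0]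
    and by [p ^ (k - 2 N) e ^ N] if [c = 0] and [p] is injective, gives vectors
    of unbounded [q]-nilpotency order in one finite-dimensional weight space. *)
Lemma kernel_q_degenerate m (v0 v1 : V) :
  irreducible q p f e h -> no_lowest_weight h -> v0 != 0 -> h v0 = m *: v0 ->
  v1 != 0 -> q v1 = 0 -> c = 0 /\ exists2 v : V, v != 0 & p v = 0.
Proof.
move=> irr [fdh below] v0_neq0 hv0 v1_neq0 qv1.
have nilq := locally_nilpotent_q irr v1_neq0 qv1.
have low N : exists (k : nat) (w : V),
    [/\ (N <= k)%N, w != 0, q w = 0 & h w = (m - k%:R) *: w].
  have [k [w [Nk w0 hw]]] : exists (k : nat) (w : V),
      [/\ (N <= k)%N, w != 0 & h w = (m - k%:R) *: w].
    elim: N => [|N [k [w [Nk w0 hw]]]]; first by exists 0%N, v0; rewrite subr0.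
    have [l [u [u0 hu]]] := below _ _ w0 hw.
    exists (k + l.+1)%N, u; split=> //; last by rewrite hu natrD opprD addrA.
    by rewrite addnS ltnS (leq_trans Nk) ?leq_addr.
  have [l /(last_nonzero_iterate w0)[j qj0 qj]] := nilq w.
  exists (k + j)%N, (iter j q w); split=> //; first exact: leq_trans Nk (leq_addr _ _).
  by rewrite (weight_q _ hw) natrD opprD addrA.
have [N bound] := nilpotency_bounded q (fdh m).
have qp v : q (p v) = p (q v) + (\- (c \*: idfun)) v.
  by rewrite (rep_pq rep) /= addrK.
have [c0|c_neq0] := eqVneq c 0; last first.
  exfalso; have [k [w [Nk w0 qw hw]]] := low N.
  have [||low1 low2] := iter_lowering k qp _ _ qw.
  - by move=> v /=; rewrite linearN [p (_ *: _)]linearZ_LR.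
  - by move=> v /=; rewrite linearN [q (_ *: _)]linearZ_LR.
  have := bound (iter k p w) k; rewrite (weight_p _ hw) subrK low2 low1.
  move=> /(_ erefl Nk erefl)/eqP; rewrite scaler_eq0 pnatr_eq0 gtn_eqF ?fact_gt0 //=.
  apply/negP; apply: iter_injective => // v /= /eqP.
  by rewrite oppr_eq0 scaler_eq0 (negPf c_neq0) => /eqP.
split=> //; apply: contrapT => injp.
have {}injp v : p v = 0 -> v = 0.
  by move=> pv; apply/eqP; apply: contra_notT injp => v_neq0; exists v.
have [k [w [Nk w0 qw hw]]] := low (N + N)%N.
have qe v : q (e v) = e (q v) + (\- p) v by rewrite (rep_eq rep) /= addrK.
have pq v : p (q v) = q (p v) by rewrite (rep_pq rep) c0 scale0r addr0.
have [||low1 low2] := iter_lowering N qe _ _ qw.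
- by move=> v /=; rewrite linearN (rep_ep rep).
- by move=> v /=; rewrite linearN pq.
have := bound (iter (k - (N + N)) p (iter N e w)) N.
rewrite (weight_p _ (weight_e _ hw)) natrB // natrD.
have qpk j l u : iter j q (iter l p u) = iter l p (iter j q u).
  by apply: iter_comm => x; apply/esym/iter_comm => y; rewrite pq.
rewrite !qpk low1 low2 linear0 => /(_ _ (leqnn N) erefl) Hz.
have /eqP : iter (k - (N + N)) p (N`!%:R *: iter N (\- p) w) = 0.
  by apply: Hz; congr (_ *: _); ring.
apply/negP/iter_injective => //; rewrite scaler_eq0 negb_or pnatr_eq0.
rewrite gtn_eqF ?fact_gt0 //=; apply: iter_injective => // v /= /eqP.
by rewrite oppr_eq0 => /eqP/injp.
Qed.

End Representation.

(** If [q] and [p] both had kernels they would have a common one, which is a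
    submodule on which both vanish. *)
Lemma injective_qp c q p f e h m (v0 : V) :
  schr_rep c q p f e h -> irreducible q p f e h ->
  no_lowest_weight h -> no_lowest_weight (\- h) ->
  v0 != 0 -> h v0 = m *: v0 ->
  (exists v, p v <> 0) \/ (exists v, q v <> 0) ->
  (forall v, q v = 0 -> v = 0) /\ (forall v, p v = 0 -> v = 0).
Proof.
move=> rep irr low high v0_neq0 hv0 nontriv.
have rep' := schr_rep_swap rep.
have irr' : irreducible p q e f (\- h).
  move=> W sW stab; apply: irr => // v /stab[Wp Wq We Wf Wh]; split=> //.
  by rewrite -[h v]opprK -scaleN1r; apply: subspaceZ.
have hv0' : (\- h) v0 = (- m) *: v0 by rewrite /= hv0 scaleNr.
have contra_both (v1 v2 : V) : c = 0 -> v1 != 0 -> q v1 = 0 -> v2 != 0 -> p v2 = 0 -> False.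
  move=> c0 v1_neq0 qv1 v2_neq0 pv2.
  have pq v : p (q v) = q (p v) by rewrite (rep_pq rep) c0 scale0r addr0.
  have [k pkv1] := locally_nilpotent_q rep' irr' v2_neq0 pv2 v1.
  have [j u_neq0 pu] := last_nonzero_iterate v1_neq0 pkv1.
  have qu : q (iter j p v1) = 0 by rewrite iter_comm // qv1 linear0.
  case: (irr (fun v => q v = 0 /\ p v = 0)).
  - split=> [|a v w [qv pv] [qw pw]]; first by rewrite !linear0.
    by rewrite !linearP qv qw pv pw scaler0 addr0.
  - move=> v [qv pv]; rewrite qv pv !linear0; split=> //; split.
    + by rewrite -(rep_fq rep) qv linear0.
    + by rewrite (rep_pf rep) pv qv linear0 subrr.
    + by have := rep_eq rep v; rewrite qv pv linear0 addr0 => /esym.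
    + by rewrite -(rep_ep rep) pv linear0.
    + by have := rep_hq rep v; rewrite qv !linear0 addr0 => /esym.
    + by have := rep_hp rep v; rewrite pv !linear0 addr0 => /esym.
  - by move/(_ (iter j p v1) (conj qu pu))/eqP; rewrite (negPf u_neq0).
  - by move=> all0; case: nontriv => -[v]; case: (all0 v).
split=> v vker; apply/eqP; apply: contrapT => /negP v_neq0.
- have [c0 [w w_neq0 pw]] := kernel_q_degenerate rep irr low v0_neq0 hv0 v_neq0 vker.
  exact: (contra_both v w).
- have [/eqP] := kernel_q_degenerate rep' irr' high v0_neq0 hv0' v_neq0 vker.
  rewrite oppr_eq0 => /eqP c0 [w w_neq0 qw].
  exact: (contra_both w v).
Qed.

(** With [z = 0] the commuting product [t = q p] satisfies [[t, f] = - q ^ 2],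
    so on a finite-dimensional weight space [q ^ -2 f] and [t] would satisfy
    the Heisenberg relation.  Starting from an eigenvector [w] of [t] with
    eigenvalue [a], the vectors [f ^ N p ^ (2 N) w] have [t - a] nilpotency
    order exactly [N + 1]. *)
Lemma central_charge_neq0 c q p f e h m (v0 : V) :
  schr_rep c q p f e h -> finite_span (fun v => h v = m *: v) ->
  v0 != 0 -> h v0 = m *: v0 ->
  (forall v, q v = 0 -> v = 0) -> (forall v, p v = 0 -> v = 0) -> c != 0.
Proof.
move=> rep fdm v0_neq0 hv0 injq injp; apply/eqP => c0.
have pq v : p (q v) = q (p v) by rewrite (rep_pq rep) c0 scale0r addr0.
have hqp v : h (q (p v)) = q (p (h v)).
  by rewrite (rep_hq rep) (rep_hp rep) linearD addrK.
have [w [a [hw w_neq0 tw]]] :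
    exists (w : V) a, [/\ h w = m *: w, w != 0 & (q \o p) w = a *: w].
  apply: (finite_span_eigenvector (subspace_eigen h m) fdm _ hv0 v0_neq0).
  by move=> v hv /=; rewrite hqp hv !linearZ.
pose A : {linear V -> V} := (q \o p) \- (a \*: idfun).
have [N bound] := nilpotency_bounded A fdm.
pose w' := iter (N + N) p w.
have Aw' : A w' = 0.
  rewrite /A /w' /= !(iter_comm _ _ (f := p)) // (iter_comm _ _ (f := q)) //.
  by move: tw => /= ->; rewrite iterZ subrr.
have Af v : A (f v) = f (A v) + (\- (q \o q)) v.
  rewrite /A /= (rep_pf rep) !linearB /= !(rep_fq rep) [f (_ *: _)]linearZ_LR.
  compare_coefficients K V; ring.
have [||low1 low2] := iter_lowering N Af _ _ Aw'.
- by move=> v /=; rewrite linearN !(rep_fq rep).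
- move=> v; rewrite /A /= !linearB !linearN /= ![q (_ *: _)]linearZ_LR !pq.
  compare_coefficients K V; ring.
have := bound (iter N f w') N; rewrite low1 low2 => /(_ _ (leqnn N) erefl) Hz.
have /eqP : N`!%:R *: iter N (\- (q \o q)) w' = 0.
  apply: Hz; rewrite (weight_f rep _ (weight_p rep _ hw)) natrD.
  by congr (_ *: _); ring.
rewrite scaler_eq0 pnatr_eq0 gtn_eqF ?fact_gt0 //=; apply/negP.
apply: iter_injective; last exact: iter_injective.
by move=> v /= /eqP; rewrite oppr_eq0 => /eqP/injq/injq.
Qed.

End Representations.

(** * The commuting copy of sl2 *)

Section CommutingSl2.
Context (K : numClosedFieldType) (V : lmodType K).
Implicit Types (v : V) (q p f e h : {linear V -> V}) (c : K).

(** For [c != 0] these operators commute with [q] and [p]; they split the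
    enveloping algebra with [z = c] into a Weyl algebra and a copy of that of
    sl2. *)
Definition sl2F c q f : {linear V -> V} := f \+ ((2 * c)^-1 \*: (q \o q)).
Definition sl2E c p e : {linear V -> V} := e \- ((2 * c)^-1 \*: (p \o p)).
Definition sl2H c q p h : {linear V -> V} :=
  (h \+ (c^-1 \*: (q \o p))) \+ (2^-1 \*: idfun).

(** The brackets, read from left to right, move [q] to the left of [f], [f] to the
    left of [p], then [e], then [h]; ordered words can be compared as atoms. *)
Ltac normal_order rep q p f e h :=
  rewrite /sl2F /sl2E /sl2H /= ?(rep_he rep, rep_hp rep, rep_hf rep,
    rep_hq rep, rep_eq rep, rep_ep rep, rep_ef rep, rep_pf rep, rep_fq rep,
    rep_pq rep, linear_opsE q, linear_opsE p, linear_opsE f, linear_opsE e,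
    linear_opsE h);
  compare_coefficients K V.

Section Relations.
Context (c : K) (q p f e h : {linear V -> V}).
Hypotheses (rep : schr_rep c q p f e h) (c_neq0 : c != 0).

Local Notation F := (sl2F c q f).
Local Notation E := (sl2E c p e).
Local Notation H := (sl2H c q p h).

Lemma sl2F_q v : F (q v) = q (F v).
Proof. normal_order rep q p f e h; ring. Qed.

Lemma sl2F_p v : F (p v) = p (F v).
Proof. normal_order rep q p f e h; by field. Qed.

Lemma sl2E_q v : E (q v) = q (E v).
Proof. normal_order rep q p f e h; by field. Qed.

Lemma sl2E_p v : E (p v) = p (E v).
Proof. normal_order rep q p f e h; ring. Qed.

Lemma sl2H_q v : H (q v) = q (H v).
Proof. normal_order rep q p f e h; by field. Qed.

Lemma sl2H_p v : H (p v) = p (H v).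
Proof. normal_order rep q p f e h; by field. Qed.

Lemma sl2HE v : H (E v) = E (H v) + 2 *: E v.
Proof. normal_order rep q p f e h; by field. Qed.

Lemma sl2HF v : H (F v) = F (H v) + (- 2) *: F v.
Proof. normal_order rep q p f e h; by field. Qed.

Lemma sl2EF v : E (F v) = F (E v) + H v.
Proof. normal_order rep q p f e h; by field. Qed.

Lemma weight_sl2E v : h (E v) = E (h v) + 2 *: E v.
Proof. normal_order rep q p f e h; by field. Qed.

Lemma weight_sl2F v : h (F v) = F (h v) + (- 2) *: F v.
Proof. normal_order rep q p f e h; by field. Qed.

Lemma weight_sl2H v : h (H v) = H (h v).
Proof. normal_order rep q p f e h; by field. Qed.

Lemma sl2H_iterF j (m : K) v : H v = m *: v ->
  H (iter j F v) = (m - j%:R * 2) *: iter j F v.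
Proof. by move=> Hv; rewrite (iter_weight _ sl2HF Hv) mulrN. Qed.

(** The vanishing of the coefficient at [j = m] is what forces the highest
    weight of a finite string to be a natural number. *)
Lemma sl2E_iterF j (m : K) v : E v = 0 -> H v = m *: v ->
  E (iter j.+1 F v) = (j.+1%:R * (m - j%:R)) *: iter j F v.
Proof.
move=> Ev Hv; elim: j => [|j IHj].
  by rewrite -[iter 1 F v]/(F v) sl2EF Ev Hv linear0 add0r mul1r subr0.
rewrite iterS sl2EF IHj linearZ_LR (sl2H_iterF _ Hv) -scalerDl.
by congr (_ *: _); rewrite -!natr1; ring.
Qed.

End Relations.

(** In a finite-dimensional weight space [H] has an eigenvector; [E] raises and
    [F] lowers its eigenvalue, and powers of the injective [q] and [p] bring the
    results back to the same weight, so both are nilpotent on it. *)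
Lemma sl2_highest_vector c q p f e h (m : K) (v0 : V) :
  schr_rep c q p f e h -> c != 0 ->
  (forall m, finite_span (fun v => h v = m *: v)) -> v0 != 0 -> h v0 = m *: v0 ->
  (forall v, q v = 0 -> v = 0) -> (forall v, p v = 0 -> v = 0) ->
  exists (w : V) (n : nat) (y : K),
    [/\ w != 0, h w = y *: w, sl2E c p e w = 0, sl2H c q p h w = n%:R *: w
      & iter n.+1 (sl2F c q f) w = 0].
Proof.
move=> rep c0 fdh v0_neq0 hv0 injq injp.
set F := sl2F c q f; set E := sl2E c p e; set H := sl2H c q p h.
have [w [a [hw w0 Hw]]] : exists (w : V) a, [/\ h w = m *: w, w != 0 & H w = a *: w].
  apply: (finite_span_eigenvector (subspace_eigen h m) (fdh m) _ hv0 v0_neq0).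
  by move=> v hv; rewrite (weight_sl2H rep c0) hv linearZ.
have HEk k := iter_weight k (sl2HE rep c0) Hw.
have [k Ek] : exists k, iter k E w = 0.
  have [k qEk] : exists k, iter (k + k) q (iter k E w) = 0.
    apply: (@eigen_string_breaks _ _ _ H _ (fun k => a + k%:R * 2) (fdh m)).
    - move=> k; rewrite (weight_q rep _ (iter_weight k (weight_sl2E rep c0) hw)).
      by rewrite natrD; congr (_ *: _); ring.
    - move=> i j /addrI/mulIf eqij; apply/eqP.
      by rewrite -(eqr_nat K) eqij // pnatr_eq0.
    - by move=> k; rewrite (iter_comm _ _ (sl2H_q rep c0)) HEk iterZ.
  by exists k; apply: contrapT => /eqP/(iter_injective (k + k) injq)/eqP.
have [j u0 Eu] := last_nonzero_iterate w0 Ek.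
set u := iter j E w in u0 Eu; set b : K := a + j%:R * 2.
have Hu : H u = b *: u by apply: HEk.
have hu := iter_weight j (weight_sl2E rep c0) hw; set y := _ + _ in hu.
have [l Fl] : exists l, iter l F u = 0.
  have [l pFl] : exists l, iter (l + l) p (iter l F u) = 0.
    apply: (@eigen_string_breaks _ _ _ H _ (fun l => b - l%:R * 2) (fdh y)).
    - move=> l; rewrite (weight_p rep _ (iter_weight l (weight_sl2F rep c0) hu)).
      by rewrite natrD; congr (_ *: _); ring.
    - move=> i i' /addrI/oppr_inj/mulIf eqi; apply/eqP.
      by rewrite -(eqr_nat K) eqi // pnatr_eq0.
    - move=> l; rewrite (iter_comm _ _ (sl2H_p rep c0)).
      by rewrite (sl2H_iterF rep c0 _ Hu) iterZ.
  by exists l; apply: contrapT => /eqP/(iter_injective (l + l) injp)/eqP.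
have [n Fn Fn1] := last_nonzero_iterate u0 Fl.
exists u, n, y; split=> //; rewrite Hu; congr (_ *: _).
have := sl2E_iterF rep c0 n Eu Hu; rewrite iterS Fn1 linear0 => /esym/eqP.
rewrite scaler_eq0 (negPf Fn) orbF mulf_eq0 pnatr_eq0 /= subr_eq0.
by move/eqP.
Qed.

End CommutingSl2.

(** * Seed families *)

(** Solves a linear equation [s = t] for one of its terms. *)
Lemma vector_eq_from (K : nzRingType) (V : lmodType K) (a : K) (s t u w : V) :
  s = t -> u - w = a *: (s - t) -> u = w.
Proof. by move=> ->; rewrite subrr scaler0 => /eqP; rewrite subr_eq0 => /eqP. Qed.

Section Seeds.
Context (K : numClosedFieldType) (V : lmodType K).
Implicit Types (v : int -> V) (q p f e h : {linear V -> V}) (c x : K) (i : int).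

(** The vectors [v_(i, 0)] of the module: a family spanning a dense module over
    the Weyl algebra of [q] and [p], all of whose members are highest-weight
    vectors of weight [n] for the commuting copy of sl2. *)
Record seed n c x q p f e h v : Prop := Seed {
  seed_q i : q (v i) = v (i + 1);
  seed_p i : p (v i) = (c * (i%:~R + x)) *: v (i - 1);
  seed_e i : e (v i)
    = (2^-1 * c * (i%:~R + x) * (i%:~R + x - 1)) *: v (i - 2);
  seed_h i : h (v i) = (n%:R - 2^-1 - (i%:~R + x)) *: v i;
  seed_F i : iter n.+1 (sl2F c q f) (v i) = 0
}.

Section Construction.
Context (n : nat) (c : K) (q p f e h : {linear V -> V}).
Hypotheses (rep : schr_rep c q p f e h) (c_neq0 : c != 0).
Hypotheses (injq : forall w, q w = 0 -> w = 0) (injp : forall w, p w = 0 -> w = 0).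

Let seed_vector (y : K) (u : V) : Prop :=
  [/\ u != 0, q (p u) = (c * y) *: u, sl2E c p e u = 0,
      sl2H c q p h u = n%:R *: u & iter n.+1 (sl2F c q f) u = 0].

Let seed_vector_q y u : seed_vector y u -> seed_vector (y + 1) (q u).
Proof.
case=> u0 qpu Eu Hu Fu; split.
- by apply: contra u0 => /eqP/injq->.
- rewrite (rep_pq rep) linearD qpu !(linear_opsE q) -scalerDl; congr (_ *: _); ring.
- by rewrite (sl2E_q rep c_neq0) Eu linear0.
- by rewrite (sl2H_q rep c_neq0) Hu linearZ.
- by rewrite -(iter_comm (f := q)) ?Fu ?linear0 // => v; rewrite (sl2F_q rep).
Qed.

Let seed_vector_neq0 y u : seed_vector y u -> c * y != 0.
Proof.
case=> u0 qpu _ _ _; apply: contra u0 => /eqP cy0.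
by move: qpu; rewrite cy0 scale0r => /injq/injp->.
Qed.

Let seed_vector_p y u : seed_vector y u ->
  seed_vector (y - 1) ((c * y)^-1 *: p u) /\ q ((c * y)^-1 *: p u) = u.
Proof.
move=> su; have cy0 := seed_vector_neq0 su; case: su => u0 qpu Eu Hu Fu.
have qpu' : q ((c * y)^-1 *: p u) = u.
  by rewrite (linear_opsE q) qpu scalerA mulVf ?scale1r.
split=> //; split.
- by apply: contra_neq u0 => pu0; rewrite -qpu' pu0 linear0.
- have qp w : q (p w) = p (q w) - c *: w by rewrite (rep_pq rep) addrK.
  rewrite !(linear_opsE q, linear_opsE p) qp qpu (linear_opsE p).
  by compare_coefficients K V; field; rewrite andbC -negb_or -mulf_eq0.
- by rewrite (linear_opsE (sl2E c p e)) (sl2E_p rep) Eu linear0 scaler0.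
- rewrite (linear_opsE (sl2H c q p h)) (sl2H_p rep c_neq0) Hu (linear_opsE p).
  by rewrite !scalerA mulrC.
- rewrite iterZ -(iter_comm (f := p)) ?Fu ?linear0 ?scaler0 // => v.
  by rewrite (sl2F_p rep c_neq0).
Qed.

(** [q] moves a seed vector up the integers.  Since [q p] has the nonzero
    eigenvalue [c y] on it, [p / (c y)] is a right inverse of [q] there and moves
    it down. *)
Lemma seed_exists y u : u != 0 -> h u = (n%:R - 2^-1 - y) *: u ->
  sl2E c p e u = 0 -> sl2H c q p h u = n%:R *: u ->
  iter n.+1 (sl2F c q f) u = 0 ->
  exists2 v, seed n c y q p f e h v & forall i, v i != 0.
Proof.
move=> u0 hu Eu Hu Fu.
pose d := fix d k := if k is k'.+1 then (c * (y - k'%:R))^-1 *: p (d k') else u.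
pose v (i : int) := match i with Posz k => iter k q u | Negz k => d k.+1 end.
have su : seed_vector y u.
  split=> //; move: Hu; rewrite /sl2H /= hu => /(vector_eq_from (a := c)); apply.
  by compare_coefficients K V; field.
have sd k : seed_vector (y - k%:R) (d k) /\ q (d k.+1) = d k.
  elim: k => [|k [IHk _]].
    rewrite subr0; have [_] := seed_vector_p su; split=> //=.
    by rewrite subr0.
  have [sk _] := seed_vector_p IHk; rewrite -addrA -opprD natr1 in sk.
  by split=> //; have [_] := seed_vector_p sk.
have sv i : seed_vector (i%:~R + y) (v i).
  case: i => k; last first.
    by rewrite addrC NegzE mulrNz; case: (sd k.+1).
  rewrite addrC; elim: k => [|k IHk]; first by rewrite addr0.
  by rewrite -[k.+1%:~R]/(k.+1%:R) -natr1 addrA; apply: seed_vector_q.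
have qv i : q (v i) = v (i + 1).
  case: i => [k|[|k]]; first by rewrite addrC -intS.
    by case: (sd 0%N).
  have -> : Negz k.+1 + 1 = Negz k by rewrite !NegzE -[k.+2]addn1 PoszD; ring.
  by case: (sd k.+1).
have pv i : p (v i) = (c * (i%:~R + y)) *: v (i - 1).
  apply/eqP; rewrite -subr_eq0; apply/eqP/injq.
  by rewrite linearB /= (linear_opsE q) qv subrK; case: (sv i) => _ -> *; rewrite subrr.
exists v => [|i]; last by case: (sv i).
split=> // i; last by case: (sv i).
- case: (sv i) => _ _ /eqP; rewrite /sl2E /= subr_eq0 => /eqP-> _ _.
  rewrite pv (linear_opsE p) pv !scalerA -addrA rmorphB /=; congr (_ *: _).
  by field.
- case: (sv i) => _ qpv _ Hv _; move: Hv; rewrite /sl2H /= qpv.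
  move=> /(vector_eq_from (a := 1)); apply.
  by compare_coefficients K V; field.
Qed.

End Construction.

End Seeds.

(** * Linear extension from a basis *)

Section LinearExtension.
Context (K : fieldType) (I : choiceType) (V : lmodType K).
Implicit Types (g : I -> V) (u w : {malg K[I]}).

Definition lext g u : V := \sum_(k <- msupp u) u@_k *: g k.

Lemma lextEw g u (d : {fset I}) :
  (msupp u `<=` d)%fset -> lext g u = \sum_(k <- d) u@_k *: g k.
Proof.
move=> sub; rewrite /lext (big_fset_incl _ sub) // => k _ /mcoeff_outdom->.
by rewrite scale0r.
Qed.

Lemma lext_is_linear g : linear (lext g).
Proof.
move=> a u w; pose d := (msupp u `|` msupp w)%fset.
rewrite (@lextEw _ u d) ?(@lextEw _ w d) ?(@lextEw _ (a *: u + w) d) ?fsubsetUl ?fsubsetUr //.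
  rewrite scaler_sumr -big_split; apply: eq_bigr => k _ /=.
  by rewrite mcoeffD mcoeffZ scalerDl scalerA.
by apply: fsubset_trans (msuppD_le _ _) _; rewrite fsetSU // msuppZ_le.
Qed.

HB.instance Definition _ g :=
  GRing.isLinear.Build K {malg K[I]} V *:%R (lext g) (lext_is_linear g).

Lemma lextU g a k : lext g << a *g k >> = a *: g k.
Proof.
by rewrite (@lextEw _ _ [fset k]%fset) ?msuppU_le // big_seq_fset1 mcoeffUU.
Qed.

Lemma lext_basis g k : lext g << k >> = g k.
Proof. by rewrite lextU scale1r. Qed.

Lemma malg_decomp u : u = \sum_(k <- msupp u) u@_k *: << k >>.
Proof.
rewrite {1}[u]monalgE; apply: eq_bigr => k _; apply/malgP => l.
by rewrite mcoeffZ !mcoeffU mulr_natr.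
Qed.

End LinearExtension.

(** * The space with basis [v_(i, j)] *)

Lemma iter_add_commuting (K : nzRingType) (V : lmodType K)
    (A B : {linear V -> V}) m v : (forall v, A (B v) = B (A v)) ->
  iter m (A \+ B) v
  = \sum_(s < m.+1) 'C(m, s)%:R *: iter (m - s) B (iter s A v).
Proof.
move=> AB; elim: m => [|m IHm].
  by rewrite big_ord_recl big_ord0 addr0 scale1r.
have BA s w : A (iter s B w) = iter s B (A w) by apply: iter_comm.
have sumA : A (\sum_(s < m.+1) 'C(m, s)%:R *: iter (m - s) B (iter s A v))
    = \sum_(s < m.+1) 'C(m, s)%:R *: iter (m - s) B (iter s.+1 A v).
  by rewrite linear_sum; apply: eq_bigr => s _; rewrite linearZ_LR BA.
have sumB : B (\sum_(s < m.+1) 'C(m, s)%:R *: iter (m - s) B (iter s A v))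
    = iter m.+1 B v
      + \sum_(s < m.+1) 'C(m, s.+1)%:R *: iter (m - s) B (iter s.+1 A v).
  rewrite linear_sum big_ord_recl [in RHS]big_ord_recr /= (bin_small (ltnSn m)) scale0r.
  rewrite addr0 bin0 subn0 !scale1r; congr (_ + _); apply: eq_bigr => s _.
  by rewrite linearZ_LR /bump leq0n add1n add0n -[in RHS](subnSK (ltn_ord s)).
rewrite iterS IHm [LHS]/= sumA sumB [in RHS]big_ord_recl subn0 bin0 scale1r.
rewrite addrCA; congr (_ + _); rewrite -big_split; apply: eq_bigr => s _ /=.
by rewrite /bump leq0n add1n binS natrD scalerDl subSS addrC.
Qed.

(** A basis indexed by the pairs [(i, j)] with [j <= n], given by its universal
    property. *)
Record free_basis (K : fieldType) (n : nat) (B : lmodType K)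
    (bvec : int -> nat -> B) : Type := FreeBasis {
  bext : forall V : lmodType K, (int -> nat -> V) -> {linear B -> V};
  bextE : forall (V : lmodType K) (g : int -> nat -> V) i j,
    (j <= n)%N -> bext g (bvec i j) = g i j;
  bvec_span : forall u, exists (r : seq (int * nat)) (a : int * nat -> K),
    [/\ uniq r, forall k, k \in r -> (k.2 <= n)%N
      & u = \sum_(k <- r) a k *: bvec k.1 k.2]
}.

Section BasisSpace.
Context (K : fieldType) (n : nat) (B : lmodType K) (bvec : int -> nat -> B).
Context (basis : free_basis n bvec).
Implicit Types (i : int) (j : nat) (a : K) (u : B).

Local Notation bext := (bext basis).

Definition bshift : {linear B -> B} := bext (fun i j => bvec (i + 1) j).

Definition btop a i : B :=
  - \sum_(0 <= s < n.+1)
      (a ^+ (n.+1 - s) * 'C(n.+1, s)%:R) *: bvec (i + 2 * n.+1%:Z - 2 * s%:Z) s.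

(** With [a = 1 / (2 c)] this is the action of [f]; with [a = 0] the relation
    for the last index becomes [v_(i, n + 1) = 0]. *)
Definition blower a : {linear B -> B} :=
  bext (fun i j => if (j < n)%N then bvec i j.+1 else btop a i).

Lemma bvec_linear_ext (V : lmodType K) (L1 L2 : {linear B -> V}) :
  (forall i j, (j <= n)%N -> L1 (bvec i j) = L2 (bvec i j)) -> L1 =1 L2.
Proof.
move=> eqL u; have [r [a [_ rn ->]]] := bvec_span basis u.
rewrite (linear_sum L1) (linear_sum L2) !big_seq; apply: eq_bigr => k rk.
by rewrite (linZ L1) (linZ L2) eqL ?rn.
Qed.

Lemma bshift_bvec i j : (j <= n)%N -> bshift (bvec i j) = bvec (i + 1) j.
Proof. exact: (bextE basis). Qed.

Lemma blower_bvec a i j : (j <= n)%N ->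
  blower a (bvec i j) = if (j < n)%N then bvec i j.+1 else btop a i.
Proof. exact: (bextE basis). Qed.

Lemma iter_blower a i j : (j <= n)%N -> iter j (blower a) (bvec i 0) = bvec i j.
Proof.
elim: j => // j IHj ltj; rewrite iterS IHj ?(ltnW ltj) // blower_bvec ?ltj //.
exact: ltnW.
Qed.

Lemma blower_bshift a u : blower a (bshift u) = bshift (blower a u).
Proof.
apply: (bvec_linear_ext (L1 := blower a \o bshift) (L2 := bshift \o blower a)).
move=> i j jn.
change (blower a (bshift (bvec i j)) = bshift (blower a (bvec i j))).
rewrite bshift_bvec // !blower_bvec //.
case: ltnP => [ltj|_]; first by rewrite bshift_bvec.
rewrite /btop (linN bshift) !big_mkord (linear_sum bshift); congr (- _).
apply: eq_bigr => s _; rewrite (linZ bshift) bshift_bvec -1?ltnS //.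
by congr (_ *: bvec _ _); ring.
Qed.

Section Family.
Context (V : lmodType K) (q f : {linear V -> V}) (v : int -> V).
Hypotheses (fq : forall w, f (q w) = q (f w)).
Hypotheses (qv : forall i, q (v i) = v (i + 1)).

Definition family_map : {linear B -> V} :=  bext (fun i j => iter j f (v i)).

Lemma family_map_bvec i j : (j <= n)%N -> family_map (bvec i j) = iter j f (v i).
Proof. exact: (bextE basis). Qed.

Lemma iterq_family k i j : iter k q (iter j f (v i)) = iter j f (v (i + k%:Z)).
Proof.
elim: k => [|k IHk]; first by rewrite addr0.
by rewrite iterS IHk (iter_comm _ _ (fun w => esym (fq w))) qv -addrA -[k.+1]addn1.
Qed.

Lemma family_map_shift u : family_map (bshift u) = q (family_map u).
Proof.
apply: (bvec_linear_ext (L1 := family_map \o bshift) (L2 := q \o family_map)).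
move=> i j jn.
change (family_map (bshift (bvec i j)) = q (family_map (bvec i j))).
rewrite bshift_bvec // !family_map_bvec //.
exact/esym/(iterq_family 1).
Qed.

(** As [f] and [q] commute, this is the binomial theorem. *)
Lemma iter_sl2_expand a m i :
  iter m (f \+ (a \*: (q \o q))) (v i) =
  \sum_(s < m.+1) (a ^+ (m - s) * 'C(m, s)%:R)
    *: iter s f (v (i + 2 * m%:Z - 2 * s%:Z)).
Proof.
rewrite iter_add_commuting => [|w /=]; last by rewrite (linZ f) !fq.
have iterB k w : iter k (a \*: (q \o q)) w = a ^+ k *: iter (k + k) q w.
  elim: k => [|k IHk]; first by rewrite scale1r.
  rewrite iterS IHk /= !(linZ q) scalerA -exprS; congr (_ *: _).
  by rewrite addnS.
apply: eq_bigr => s _; rewrite iterB iterq_family scalerA mulrC.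
congr (_ *: iter _ _ (v _)); rewrite PoszD -subzn -1?ltnS //; ring.
Qed.

(** Only the last index needs an argument: there the vanishing of
    [(f + a q ^ 2) ^ (n + 1) v_i] expresses [f ^ (n + 1) v_i] by lower powers. *)
Lemma family_map_lower a :
  (forall i, iter n.+1 (f \+ (a \*: (q \o q))) (v i) = 0) ->
  forall u, family_map (blower a u) = f (family_map u).
Proof.
move=> top u.
apply: (bvec_linear_ext (L1 := family_map \o blower a) (L2 := f \o family_map)).
move=> i j jn.
change (family_map (blower a (bvec i j)) = f (family_map (bvec i j))).
rewrite blower_bvec // [in RHS]family_map_bvec //.
case: ltnP => [ltj|nj]; first by rewrite family_map_bvec.
have -> : j = n by apply/eqP; rewrite eqn_leq jn.
have := top i; rewrite iter_sl2_expand big_ord_recr /= subnn expr0 binn mul1r scale1r.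
rewrite addrK => /eqP; rewrite addrC addr_eq0 => /eqP ->.
rewrite /btop (linN family_map) big_mkord (linear_sum family_map).
congr (- _); apply: eq_bigr => s _.
by rewrite (linZ family_map) family_map_bvec -1?ltnS.
Qed.

End Family.

Lemma iter_blower_top a i :
  iter n.+1 (blower a \+ (a \*: (bshift \o bshift))) (bvec i 0) = 0.
Proof.
rewrite (iter_sl2_expand (v := fun i => bvec i 0)).
- rewrite big_ord_recr /= subnn expr0 binn mul1r scale1r addrK.
  rewrite iter_blower // blower_bvec // ltnn /btop big_mkord.
  apply/eqP; rewrite subr_eq0; apply/eqP/eq_bigr => s _.
  by rewrite iter_blower -1?ltnS.
- exact: blower_bshift.
- by move=> k; rewrite bshift_bvec.
Qed.

(** The operators [blower a + a q ^ 2] and [blower b + b q ^ 2] have the same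
    nilpotency, so [blower a] can be sent to [blower b + (b - a) q ^ 2] by a
    change of basis fixing the vectors [v_(i, 0)]. *)
Definition bchange a b : {linear B -> B} :=
  family_map (blower b \+ ((b - a) \*: (bshift \o bshift))) (fun i => bvec i 0).

Lemma bchange_shift a b u : bchange a b (bshift u) = bshift (bchange a b u).
Proof.
apply: family_map_shift => [w /=|i]; last by rewrite bshift_bvec.
by rewrite (linD bshift) (linZ bshift) blower_bshift.
Qed.

Lemma bchange_lower a b u : bchange a b (blower a u)
  = blower b (bchange a b u) + (b - a) *: bshift (bshift (bchange a b u)).
Proof.
apply: (family_map_lower (q := bshift)) => [w /=|i|i].
- by rewrite (linD bshift) (linZ bshift) blower_bshift.
- by rewrite bshift_bvec.
- rewrite -[RHS](iter_blower_top b i); apply: eq_iter => w /=.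
  by rewrite -addrA -scalerDl subrK.
Qed.

Lemma bchange_bvec0 a b i : bchange a b (bvec i 0) = bvec i 0.
Proof. by rewrite /bchange family_map_bvec. Qed.

(** The composite commutes with [blower a] and fixes the vectors [v_(i, 0)],
    which generate. *)
Lemma bchangeK a b : cancel (bchange a b) (bchange b a).
Proof.
move=> u; apply: (bvec_linear_ext (L1 := bchange b a \o bchange a b) (L2 := idfun)).
move=> i j jn.
change (bchange b a (bchange a b (bvec i j)) = bvec i j).
rewrite -(iter_blower a i jn) {u}.
elim: j jn => [|j IHj] jn; first by rewrite !bchange_bvec0.
rewrite iterS bchange_lower (linD (bchange b a)) (linZ (bchange b a)) bchange_lower !bchange_shift.
by rewrite IHj ?(ltnW jn) // -addrA -scalerDl addrC -opprB addNr scale0r add0r.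
Qed.

End BasisSpace.

(** * The module with the prescribed formulas *)

Section StandardModule.
Context (K : numClosedFieldType).

(** A Weyl algebra and a commuting sl2 recombine into the Schroedinger algebra. *)
Lemma schr_rep_of_weyl_sl2 (V : lmodType K) c (q p f e h F E H : {linear V -> V}) :
  c != 0 -> sl2F c q f =1 F -> sl2E c p e =1 E -> sl2H c q p h =1 H ->
  (forall v, p (q v) = q (p v) + c *: v) ->
  (forall v, F (q v) = q (F v)) -> (forall v, F (p v) = p (F v)) ->
  (forall v, E (q v) = q (E v)) -> (forall v, E (p v) = p (E v)) ->
  (forall v, H (q v) = q (H v)) -> (forall v, H (p v) = p (H v)) ->
  (forall v, H (E v) = E (H v) + 2 *: E v) ->
  (forall v, H (F v) = F (H v) - 2 *: F v) ->
  (forall v, E (F v) = F (E v) + H v) ->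
  schr_rep c q p f e h.
Proof.
move=> c0 FE EE HE pq Fq Fp Eq Ep Hq Hp HEv HF EF.
have fv v : f v = F v - (2 * c)^-1 *: q (q v).
  by apply: (vector_eq_from (a := 1) (FE v)); rewrite /sl2F /=; compare_coefficients K V; ring.
have ev v : e v = E v + (2 * c)^-1 *: p (p v).
  by apply: (vector_eq_from (a := 1) (EE v)); rewrite /sl2E /=; compare_coefficients K V; ring.
have hv v : h v = H v - c^-1 *: q (p v) - 2^-1 *: v.
  by apply: (vector_eq_from (a := 1) (HE v)); rewrite /sl2H /=; compare_coefficients K V; ring.
split=> v; rewrite ?(fv, ev, hv) ?(linear_opsE q, linear_opsE p, linear_opsE F,
  linear_opsE E, linear_opsE H, pq, Fq, Fp, Eq, Ep, Hq, Hp, HEv, HF, EF);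
  compare_coefficients K V; by field.
Qed.

Lemma schr_rep_transfer (V W : lmodType K) c (phi : {linear V -> W})
    (q p f e h : {linear V -> V}) (q' p' f' e' h' : {linear W -> W}) :
  injective phi -> schr_rep c q' p' f' e' h' ->
  (forall v, phi (q v) = q' (phi v)) -> (forall v, phi (p v) = p' (phi v)) ->
  (forall v, phi (f v) = f' (phi v)) -> (forall v, phi (e v) = e' (phi v)) ->
  (forall v, phi (h v) = h' (phi v)) -> schr_rep c q p f e h.
Proof.
move=> inj rep Pq Pp Pf Pe Ph.
split=> v; apply: inj; rewrite !(Pq, Pp, Pf, Pe, Ph, linD phi, linN phi, linZ phi).
- exact: rep_he rep _.
- exact: rep_hp rep _.
- exact: rep_hf rep _.
- exact: rep_hq rep _.
- exact: rep_eq rep _.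
- exact: rep_ep rep _.
- exact: rep_ef rep _.
- exact: rep_pf rep _.
- exact: rep_fq rep _.
- exact: rep_pq rep _.
Qed.

Section StringFormulas.
Context (V : lmodType K) (c : K) (q p f e h : {linear V -> V}).
Hypothesis rep : schr_rep c q p f e h.

Lemma p_iterf j v :
  p (iter j f v) = iter j f (p v) - j%:R *: iter j.-1 f (q v).
Proof.
case: j => [|j]; first by rewrite scale0r subr0.
rewrite (iter_commutator (Z := \- q)) => [|w|w] /=.
- by rewrite -scalerN; congr (_ + _ *: _); apply: (linN (iter j f)).
- exact: rep_pf rep _.
- by rewrite (linN f) (rep_fq rep).
Qed.

Lemma e_iterf j m v : h v = m *: v ->
  e (iter j f v) = iter j f (e v) + (j%:R * (m + 1 - j%:R)) *: iter j.-1 f v.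
Proof.
move=> hv; elim: j => [|j IHj]; first by rewrite mul0r scale0r addr0.
rewrite iterS (rep_ef rep) IHj (weight_f rep _ hv) (linD f) (linZ f) -iterS -addrA.
congr (_ + _); case: j {IHj} => [|j].
  by rewrite mul0r scale0r add0r; congr (_ *: _); ring.
by rewrite -iterS -scalerDl; congr (_ *: _); rewrite -!natr1; ring.
Qed.

End StringFormulas.

Section Formulas.
Context (n : nat) (B : lmodType K) (bvec : int -> nat -> B).
Context (basis : free_basis n bvec) (c x : K).
Hypothesis c_neq0 : c != 0.

Local Notation y i := (i%:~R + x).

Definition bp : {linear B -> B} := bext basis (fun i j =>
  - (j%:R *: bvec (i + 1) j.-1) + (c * y i) *: bvec (i - 1) j).

Definition be : {linear B -> B} := bext basis (fun i j =>
  (j%:R * (n%:R - 2^-1 + 1 - y i - j%:R)) *: bvec i j.-1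
  + (2^-1 * c * y i * (y i - 1)) *: bvec (i - 2) j).

Definition bh : {linear B -> B} := bext basis (fun i j =>
  (n%:R - 2^-1 - y i - 2 * j%:R) *: bvec i j).

Local Notation bq := (bshift basis).
Local Notation bf := (blower basis (2 * c)^-1).

Section Seeded.
Context (V : lmodType K) (q p f e h : {linear V -> V}) (v : int -> V).
Hypotheses (rep : schr_rep c q p f e h) (sv : seed n c x q p f e h v).

Local Notation phi := (family_map basis f v).

Lemma family_map_q u : phi (bq u) = q (phi u).
Proof. apply: family_map_shift; [exact: rep_fq rep | exact: seed_q sv]. Qed.

Lemma family_map_f u : phi (bf u) = f (phi u).
Proof.
apply: family_map_lower; [exact: rep_fq rep | exact: seed_q sv | exact: seed_F sv].
Qed.

Lemma family_map_p u : phi (bp u) = p (phi u).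
Proof.
apply: (bvec_linear_ext basis (L1 := phi \o bp) (L2 := p \o phi)) => i j jn.
change (phi (bp (bvec i j)) = p (phi (bvec i j))).
rewrite /bp (bextE basis) // (linD phi) (linN phi) !(linZ phi) !family_map_bvec //.
  rewrite (p_iterf rep) (seed_p sv) (seed_q sv) (linZ (iter j f)) addrC.
  by [].
exact: leq_trans (leq_pred _) jn.
Qed.

Lemma family_map_h u : phi (bh u) = h (phi u).
Proof.
apply: (bvec_linear_ext basis (L1 := phi \o bh) (L2 := h \o phi)) => i j jn.
change (phi (bh (bvec i j)) = h (phi (bvec i j))).
rewrite /bh (bextE basis) // (linZ phi) family_map_bvec //.
by rewrite (weight_f rep _ (seed_h sv i)); congr (_ *: _); ring.
Qed.

Lemma family_map_e u : phi (be u) = e (phi u).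
Proof.
apply: (bvec_linear_ext basis (L1 := phi \o be) (L2 := e \o phi)) => i j jn.
change (phi (be (bvec i j)) = e (phi (bvec i j))).
rewrite /be (bextE basis) // (linD phi) !(linZ phi) !family_map_bvec //; last first.
  exact: leq_trans (leq_pred _) jn.
rewrite (e_iterf rep _ (seed_h sv i)) (seed_e sv) (linZ (iter j f)) addrC.
by congr (_ + _ *: _); ring.
Qed.

End Seeded.

(** * The tensor product of a Weyl module and an sl2-module *)

Definition tp : {linear B -> B} :=
  bext basis (fun i j => (c * y i) *: bvec (i - 1) j).

Definition tE : {linear B -> B} :=
  bext basis (fun i j => (j%:R * (n.+1%:R - j%:R)) *: bvec i j.-1).

Definition tH : {linear B -> B} :=
  bext basis (fun i j => (n%:R - 2 * j%:R) *: bvec i j).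

Local Notation tF := (blower basis 0).

(* The coefficient is written [0 - 1 / (2 c)] so that [bchange _ (2 * c)^-1 0] is
   definitionally the map of the family [f ^ j v_(i, 0)]. *)
Definition tf : {linear B -> B} := tF \+ ((0 - (2 * c)^-1) \*: (bq \o bq)).
Definition te : {linear B -> B} := tE \+ ((2 * c)^-1 \*: (tp \o tp)).
Definition th : {linear B -> B} :=
  (tH \- (c^-1 \*: (bq \o tp))) \- (2^-1 \*: idfun).

Lemma tF_bvec i j : (j <= n)%N ->
  tF (bvec i j) = if (j < n)%N then bvec i j.+1 else 0.
Proof.
move=> jn; rewrite blower_bvec //; case: ltnP => // _.
rewrite /btop big_mkord big1 ?oppr0 // => s _.
by rewrite -(subnSK (ltn_ord s)) expr0n /= mul0r scale0r.
Qed.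

Lemma tp_bvec i j : (j <= n)%N -> tp (bvec i j) = (c * y i) *: bvec (i - 1) j.
Proof. exact: (bextE basis). Qed.

Lemma tE_bvec i j : (j <= n)%N ->
  tE (bvec i j) = (j%:R * (n.+1%:R - j%:R)) *: bvec i j.-1.
Proof. exact: (bextE basis). Qed.

Lemma tH_bvec i j : (j <= n)%N -> tH (bvec i j) = (n%:R - 2 * j%:R) *: bvec i j.
Proof. exact: (bextE basis). Qed.

Lemma tensor_rep : schr_rep c bq tp tf te th.
Proof.
have pj (j : nat) : (j <= n)%N -> (j.-1 <= n)%N by apply: leq_trans (leq_pred _).
apply: (schr_rep_of_weyl_sl2 (F := tF) (E := tE) (H := tH)) => //.
- by move=> u; rewrite /sl2F /tf /=; compare_coefficients K B; ring.
- by move=> u; rewrite /sl2E /te /=; compare_coefficients K B; ring.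
- by move=> u; rewrite /sl2H /th /=; compare_coefficients K B; ring.
- apply: (bvec_linear_ext basis (L1 := tp \o bq) (L2 := (bq \o tp) \+ (c \*: idfun))).
  move=> i j jn /=; rewrite bshift_bvec // !tp_bvec // (linZ bq) bshift_bvec //.
  rewrite addrK subrK -scalerDl; congr (_ *: _); rewrite rmorphD /=; ring.
- exact: blower_bshift.
- apply: (bvec_linear_ext basis (L1 := tF \o tp) (L2 := tp \o tF)) => i j jn /=.
  rewrite tp_bvec // (linZ tF) !tF_bvec //; case: ltnP => [ltj|_].
    by rewrite tp_bvec.
  by rewrite (linear0 tp) scaler0.
- apply: (bvec_linear_ext basis (L1 := tE \o bq) (L2 := bq \o tE)) => i j jn /=.
  by rewrite bshift_bvec // !tE_bvec // (linZ bq) bshift_bvec // pj.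
- apply: (bvec_linear_ext basis (L1 := tE \o tp) (L2 := tp \o tE)) => i j jn /=.
  rewrite tp_bvec // (linZ tE) !tE_bvec // (linZ tp) tp_bvec ?pj //.
  by rewrite !scalerA mulrC.
- apply: (bvec_linear_ext basis (L1 := tH \o bq) (L2 := bq \o tH)) => i j jn /=.
  by rewrite bshift_bvec // !tH_bvec // (linZ bq) bshift_bvec.
- apply: (bvec_linear_ext basis (L1 := tH \o tp) (L2 := tp \o tH)) => i j jn /=.
  rewrite tp_bvec // (linZ tH) !tH_bvec // (linZ tp) tp_bvec //.
  by rewrite !scalerA mulrC.
- apply: (bvec_linear_ext basis (L1 := tH \o tE)
            (L2 := (tE \o tH) \+ (2 \*: tE))) => i [|j] jn /=.
    rewrite tH_bvec // (linZ tE) tE_bvec // mul0r scale0r (linear0 tH).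
    by rewrite !scaler0 addr0.
  rewrite tE_bvec // (linZ tH) !tH_bvec ?(ltnW jn) // (linZ tE) tE_bvec //= !scalerA.
  by rewrite -scalerDl; congr (_ *: _); rewrite -!natr1; ring.
- apply: (bvec_linear_ext basis (L1 := tH \o tF)
            (L2 := (tF \o tH) \- (2 \*: tF))) => i j jn /=.
  rewrite tH_bvec // (linZ tF) tF_bvec //; case: ltnP => [ltj|_].
    rewrite tH_bvec // -scalerBl; congr (_ *: _); rewrite -natr1; ring.
  by rewrite (linear0 tH) !scaler0 subr0.
- apply: (bvec_linear_ext basis (L1 := tE \o tF)
            (L2 := (tF \o tE) \+ tH)) => i j jn /=.
  rewrite tF_bvec // tE_bvec // tH_bvec // (linZ tF) tF_bvec ?pj //.
  case: j jn => [|j] jn /=.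
    rewrite mul0r scale0r add0r; case: ltnP => [lt0|]; first by rewrite tE_bvec // -natr1; congr (_ *: _); ring.
    by rewrite leqn0 => /eqP->; rewrite (linear0 tE) mulr0 subr0 scale0r.
  rewrite jn; case: ltnP => [ltj|nj].
    rewrite tE_bvec // -scalerDl; congr (_ *: _); rewrite -!natr1; ring.
  have nE : n%:R = j.+1%:R :> K by congr _%:R; apply/eqP; rewrite eqn_leq nj.
  rewrite (linear0 tE) -scalerDl -!natr1 nE -natr1; apply/esym/eqP.
  by rewrite scaler_eq0; apply/orP; left; apply/eqP; ring.
Qed.

Lemma tensor_seed : seed n c x bq tp tf te th (fun i => bvec i 0).
Proof.
have FE u : sl2F c bq tf u = tF u.
  by rewrite /sl2F /tf /=; compare_coefficients K B; ring.
split=> i.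
- exact: bshift_bvec.
- exact: tp_bvec.
- rewrite /te /= tE_bvec // mul0r scale0r add0r tp_bvec // (linZ tp) tp_bvec //.
  by rewrite !scalerA -addrA rmorphB /=; congr (_ *: _); field.
- rewrite /th /= tH_bvec // tp_bvec // (linZ bq) bshift_bvec // subrK.
  by compare_coefficients K B; field.
- rewrite (eq_iter FE) iterS (iter_blower basis 0 i (leqnn n)) tF_bvec // ltnn.
  by [].
Qed.

(** The prescribed operators are those of the tensor module in the basis
    [f ^ j w_(i, 0)], so they inherit its brackets; no bracket has to be computed
    from the formula for [f v_(i, n)]. *)
Lemma standard_rep : schr_rep c bq bp bf be bh.
Proof.
have rep := tensor_rep; have sd := tensor_seed.
apply: (@schr_rep_transfer _ _ _ (bchange basis (2 * c)^-1 0) _ _ _ _ _ _ _ _ _ _ _ rep).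
- exact: can_inj (bchangeK _ _ _).
- exact: family_map_q rep sd.
- exact: family_map_p rep sd.
- exact: family_map_f rep sd.
- exact: family_map_e rep sd.
- exact: family_map_h rep sd.
Qed.

End Formulas.
End StandardModule.

(** * Recovering the parameters *)

Section Recovery.
Context (K : numClosedFieldType) (n : nat) (B : lmodType K).
Context (bvec : int -> nat -> B) (basis : free_basis n bvec).
Context (V : lmodType K) (c x : K) (q p f e h : {linear V -> V}) (v : int -> V).
Hypotheses (rep : schr_rep c q p f e h) (c_neq0 : c != 0).
Hypotheses (sv : seed n c x q p f e h v) (v_neq0 : forall i, v i != 0).

Local Notation F := (sl2F c q f).
Local Notation E := (sl2E c p e).
Local Notation H := (sl2H c q p h).

Lemma seed_qp i : q (p (v i)) = (c * (i%:~R + x)) *: v i.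
Proof. by rewrite (seed_p sv) (linZ q) (seed_q sv) subrK. Qed.

Lemma seed_E i : E (v i) = 0.
Proof.
rewrite /sl2E /= (seed_e sv) (seed_p sv) (linZ p) (seed_p sv) !scalerA.
have -> : i - 2 = i - 1 - 1 by ring.
by rewrite rmorphB /=; compare_coefficients K V; field.
Qed.

Lemma seed_H i : H (v i) = n%:R *: v i.
Proof.
rewrite /sl2H /= seed_qp (seed_h sv); compare_coefficients K V; by field.
Qed.

Lemma iterF_seed_neq0 i j : (j <= n)%N -> iter j F (v i) != 0.
Proof.
elim: j => [|j IHj] jn; first exact: v_neq0.
have := IHj (ltnW jn); apply: contra_neq => Fj.
have := sl2E_iterF rep c_neq0 j (seed_E i) (seed_H i).
rewrite Fj linear0 => /esym/eqP; rewrite scaler_eq0 mulf_eq0 pnatr_eq0 /=.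
by rewrite subr_eq0 eqr_nat gtn_eqF //= => /eqP.
Qed.

(** The eigenvalue of [D] on [F ^ j v_i] is [(n + 1) i + j] up to a constant, and
    [j <= n], so that division by [n + 1] recovers [i] and [j]. *)
Let D : {linear V -> V} := (n.+1%:R \*: (c^-1 \*: (q \o p))) \- (2^-1 \*: H).

Let D_iterF i j : D (iter j F (v i))
  = (n.+1%:R * (i%:~R + x) - 2^-1 * (n%:R - j%:R * 2)) *: iter j F (v i).
Proof.
have qpF : q (p (iter j F (v i))) = (c * (i%:~R + x)) *: iter j F (v i).
  rewrite (iter_comm _ _ (fun w => esym (sl2F_p rep c_neq0 w))).
  rewrite (iter_comm _ _ (fun w => esym (sl2F_q rep w))) seed_qp.
  exact: iterZ.
have HF := sl2H_iterF rep c_neq0 j (seed_H i).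
rewrite -[LHS]/(n.+1%:R *: (c^-1 *: q (p (iter j F (v i))))
                - 2^-1 *: H (iter j F (v i))) qpF HF.
by rewrite !scalerA -scalerBl; congr (_ *: _); field.
Qed.

Let D_separates (k l : int * nat) : (k.2 <= n)%N -> (l.2 <= n)%N ->
  n.+1%:R * (k.1%:~R + x) - 2^-1 * (n%:R - k.2%:R * 2)
  = n.+1%:R * (l.1%:~R + x) - 2^-1 * (n%:R - l.2%:R * 2) -> k = l.
Proof.
case: k l => [i j] [i' j'] /= jn jn' eqD.
have eqZ : n.+1%:Z * i + j%:Z = n.+1%:Z * i' + j'%:Z.
  apply: (@intr_inj K); rewrite !(rmorphD, rmorphM) /= -!pmulrn.
  have two0 : 2 != 0 :> K by rewrite pnatr_eq0.
  have eqh (m : nat) (z : K) : n.+1%:R * (z + x) - 2^-1 * (n%:R - m%:R * 2)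
      = n.+1%:R * z + m%:R + (n.+1%:R * x - 2^-1 * n%:R) by field.
  by move: eqD; rewrite !eqh => /addIr.
have ei : i = i'.
  have diff : n.+1%:Z * (i - i') = j'%:Z - j%:Z.
    by rewrite mulrBr; apply/eqP; rewrite subr_eq addrAC eq_sym subr_eq eqZ addrC.
  case: (ltgtP i i') => // lt_i.
    have : 0 <= n.+1%:Z * (i' - i - 1) by apply: mulr_ge0 => //; lia.
    have -> : i' - i - 1 = - (i - i') - 1 by ring.
    by rewrite mulrBr mulrN diff mulr1; lia.
  have : 0 <= n.+1%:Z * (i - i' - 1) by apply: mulr_ge0 => //; lia.
  by rewrite mulrBr diff mulr1; lia.
by move: eqZ; rewrite ei => /addrI[->].
Qed.

Lemma family_mapF_injective : injective (family_map basis F v).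
Proof.
suff inj0 u : family_map basis F v u = 0 -> u = 0.
  move=> u w eq_uw; apply/eqP; rewrite -subr_eq0; apply/eqP/inj0.
  by rewrite linearB /= eq_uw subrr.
have [r [a [uniqr rn ->]]] := bvec_span basis u.
rewrite (linear_sum (family_map basis F v)) => Fu0.
rewrite big_seq big1 // => k rk.
have : family_map basis F v (a k *: bvec k.1 k.2) = 0.
  apply: (eigen_components (W := fun w => w = 0) (D := D) (r := r)
    (u := fun k => family_map basis F v (a k *: bvec k.1 k.2))
    (lam := fun k => n.+1%:R * (k.1%:~R + x) - 2^-1 * (n%:R - k.2%:R * 2))) => //.
  - exact: subspace_eq0.
  - by move=> w ->; rewrite linear0.
  - by move=> l m /rn ln /rn mn; apply: D_separates.
  - move=> l /rn ln; rewrite (linZ (family_map _ _ _)) family_map_bvec // (linZ D).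
    by rewrite D_iterF !scalerA mulrC.
rewrite (linZ (family_map _ _ _)) family_map_bvec ?rn // => /eqP.
by rewrite scaler_eq0 (negPf (iterF_seed_neq0 _ (rn _ rk))) orbF => /eqP->; rewrite scale0r.
Qed.

(** The basis [f ^ j v_i] is obtained from [F ^ j v_i] by [bchange]. *)
Lemma family_map_injective : injective (family_map basis f v).
Proof.
set chi := family_map basis F v.
have Fq := sl2F_q rep.
have chiq u : chi (bshift basis u) = q (chi u).
  by apply: family_map_shift => // i; apply: seed_q sv i.
have chiF u : chi (blower basis 0 u) = F (chi u).
  apply: (@family_map_lower _ _ _ _ basis _ q F v) => // [i|i]; first exact: seed_q sv i.
  rewrite -[RHS](seed_F sv i); apply: eq_iter => w /=.
  by rewrite scale0r addr0.
have factor : family_map basis f v =1 chi \o bchange basis (2 * c)^-1 0.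
  apply: (bvec_linear_ext basis) => i j jn; rewrite family_map_bvec //=.
  rewrite /bchange family_map_bvec //; elim: j jn => [|j IHj] jn.
    by rewrite /chi family_map_bvec.
  rewrite !iterS IHj ?(ltnW jn) //; set w := iter j _ _.
  rewrite -[RHS]/(chi (blower basis 0 w
    + (0 - (2 * c)^-1) *: bshift basis (bshift basis w))).
  rewrite (linD chi) (linZ chi) chiF !chiq /sl2F /=.
  by compare_coefficients K V; ring.
move=> u w; rewrite !factor /= => /family_mapF_injective.
exact: can_inj (bchangeK _ _ _) u w.
Qed.

End Recovery.

Section StandardInvariants.
Context (K : numClosedFieldType) (n : nat) (B : lmodType K).
Context (bvec : int -> nat -> B) (basis : free_basis n bvec).
Context (c x : K) (c_neq0 : c != 0).

Local Notation bq := (bshift basis).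
Local Notation bf := (blower basis (2 * c)^-1).
Local Notation F := (sl2F c bq bf).

Lemma bvec_free (r : seq (int * nat)) (a : int * nat -> K) :
  uniq r -> (forall k, k \in r -> (k.2 <= n)%N) ->
  \sum_(k <- r) a k *: bvec k.1 k.2 = 0 -> forall k, k \in r -> a k = 0.
Proof.
move=> uniqr rn rel k rk.
pose L : {linear B -> K^o} :=
  bext basis (V := K^o) (fun i j => ((i, j) == k)%:R : K^o).
have LE l : l \in r -> L (bvec l.1 l.2) = (l == k)%:R.
  by move=> rl; rewrite /L (bextE basis) ?rn //; case: l rl.
have := congr1 L rel; rewrite (linear_sum L) linear0 (bigD1_seq k) //=.
rewrite (linZ L) LE // eqxx big_seq_cond big1 => [|l /andP[rl nel]].
  by rewrite addr0 [_ *: _]mulr1.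
by rewrite (linZ L) LE // (negPf nel) scaler0.
Qed.

Lemma bvec_neq0 i j : (j <= n)%N -> bvec i j != 0.
Proof.
move=> jn; apply/eqP => b0.
have one0 : (1 : K) = 0.
  apply: (@bvec_free [:: (i, j)] (fun=> 1)) (mem_head _ _) => // [k|].
    by rewrite inE => /eqP->.
  by rewrite big_seq1 b0 scaler0.
by move/eqP: one0; rewrite oner_eq0.
Qed.

(** [h] is diagonal in the basis. *)
Lemma standard_weights m u : u != 0 -> bh basis x u = m *: u ->
  exists (i : int) (j : nat), m = n%:R - 2^-1 - (i%:~R + x) - 2 * j%:R.
Proof.
move=> u_neq0; have [r [a [uniqr rn uE]]] := bvec_span basis u.
pose w (k : int * nat) : K := n%:R - 2^-1 - (k.1%:~R + x) - 2 * k.2%:R.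
have [[k rk wk] _|no_weight] := pselect (exists2 k, k \in r & m = w k).
  by exists k.1, k.2.
move=> hu; case/eqP: u_neq0; rewrite uE big_seq big1 // => k rk.
suff -> : a k = 0 by rewrite scale0r.
have wm : w k - m != 0.
  by rewrite subr_eq0; apply: contra_notN no_weight => /eqP wk; exists k.
apply: (mulIf wm); rewrite mul0r.
apply: (bvec_free (a := fun k => a k * (w k - m)) uniqr rn _ rk).
transitivity (bh basis x u - m *: u); last by rewrite hu subrr.
rewrite uE (linear_sum (bh basis x)) scaler_sumr -sumrB.
rewrite !big_seq; apply: eq_bigr => l rl.
rewrite (linZ (bh basis x)) /bh (bextE basis) ?rn // -/(w l).
by rewrite mulrBr scalerBl !scalerA [m * _]mulrC.
Qed.

(** [F] commutes with [f], so it suffices that [F ^ (n + 1)] kills the vectors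
    [v_(i, 0)]. *)
Lemma standard_F_nilpotent u : iter n.+1 F u = 0.
Proof.
have [r [a [_ rn ->]]] := bvec_span basis u.
rewrite (linear_sum (iter n.+1 F)) big_seq big1 // => k rk.
apply: (etrans (iterZ _ _ _ _)); rewrite -(iter_blower basis (2 * c)^-1 _ (rn _ rk)).
have Ff w : bf (F w) = F (bf w).
  rewrite /sl2F /= (linD bf) (linZ bf) !blower_bshift //.
have Ffk l w : iter l F (bf w) = bf (iter l F w).
  by apply/esym/iter_comm.
have -> : iter n.+1 F (iter k.2 bf (bvec k.1 0))
    = iter k.2 bf (iter n.+1 F (bvec k.1 0)).
  by apply: iter_comm => w; apply: Ffk.
by rewrite (iter_blower_top basis) linear0 scaler0.
Qed.

(** In the tensor model [F ^ n w_(0, 0) = w_(0, n)]. *)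
Lemma standard_F_nonzero : iter n F (bvec 0 0) != 0.
Proof.
pose phi := bchange basis (2 * c)^-1 0.
have phiF u : phi (F u) = blower basis 0 (phi u).
  rewrite -[F u]/(bf u + (2 * c)^-1 *: bq (bq u)) (linD phi) (linZ phi).
  rewrite /phi bchange_lower !bchange_shift -addrA -scalerDl.
  by rewrite sub0r addNr scale0r addr0.
have phiFk k w : phi (iter k F w) = iter k (blower basis 0) (phi w).
  by elim: k => //= k <-; rewrite -phiF.
apply: contra_neq (bvec_neq0 0 (leqnn n)) => Fn0.
rewrite -(iter_blower basis 0 0 (leqnn n)) -(bchange_bvec0 basis (2 * c)^-1 0 0).
by rewrite -phiFk Fn0 linear0.
Qed.

End StandardInvariants.

(** * Modules over the enveloping algebra *)

Section Enveloping.
Context (R : realType).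
Local Notation C := R[i].
Local Notation U := (Uenv R).
Implicit Types (g : sgen) (s t : schr R) (u : U).

Lemma sum_sbasis (V : lmodType C) g (F : sgen -> V) :
  \sum_g' sbasis R g g' *: F g' = F g.
Proof.
rewrite (bigD1 g) //= ffunE eqxx scale1r big1 ?addr0 // => g' neg.
by rewrite ffunE (negPf neg) scale0r.
Qed.

Lemma stens_in_basis g :
  stens_in (sbasis R g) = << fmu g >> :> {malg C[{fmonom sgen}]}.
Proof. exact: (sum_sbasis g (fun g => << fmu g >> : {malg C[{fmonom sgen}]})). Qed.

Lemma sbracket_basis (a b : sgen) :
  sbracket (sbasis R a) (sbasis R b) = sbracket_gen R a b.
Proof.
rewrite /sbracket -[RHS](sum_sbasis a (fun a => sbracket_gen R a b)).
apply: eq_bigr => a' _; rewrite -(sum_sbasis b (sbracket_gen R a')) scaler_sumr.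
by apply: eq_bigr => b' _; rewrite scalerA.
Qed.

Lemma qpi_linear : linear (qpi (@env_rel R)).
Proof. by move=> a u w; rewrite qpiD qpiZ. Qed.

HB.instance Definition _ :=
  GRing.isLinear.Build C (stens R) U *:%R (qpi (@env_rel R)) qpi_linear.

Lemma qpi_mul (u w : stens R) :
  qpi (@env_rel R) (u * w) = qpi (@env_rel R) u * qpi (@env_rel R) w.
Proof. exact: qpiM. Qed.

Lemma qpiB (u w : stens R) :
  qpi (@env_rel R) (u - w) = qpi (@env_rel R) u - qpi (@env_rel R) w.
Proof. exact: (linearB (qpi (@env_rel R)) u w). Qed.

Lemma qpi_sum (I : Type) (r : seq I) (F : I -> stens R) :
  qpi (@env_rel R) (\sum_(i <- r) F i) = \sum_(i <- r) qpi (@env_rel R) (F i).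
Proof. exact: (linear_sum (qpi (@env_rel R))). Qed.

Lemma qpi_stens_in s : qpi (@env_rel R) (stens_in s) = \sum_g s g *: ugen R g.
Proof.
apply: etrans (qpi_sum _ _) _; apply: eq_bigr => g _.
by apply: etrans (qpiZ _ _ _) _; rewrite /ugen stens_in_basis.
Qed.

Lemma ugen_bracket (a b : sgen) : ugen R a * ugen R b - ugen R b * ugen R a
  = \sum_g sbracket_gen R a b g *: ugen R g.
Proof.
rewrite -qpi_stens_in -sbracket_basis.
set x := stens_in (sbasis R a); set y := stens_in (sbasis R b).
have xy : qpi (@env_rel R) (x * y) = ugen R a * ugen R b := qpi_mul x y.
have yx : qpi (@env_rel R) (y * x) = ugen R b * ugen R a := qpi_mul y x.
apply: (etrans (esym (f_equal2 (fun s t : U => s - t) xy yx))).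
apply: (etrans (esym (qpiB (x * y) (y * x)))).
apply/qpiE.
set r := _ - _ - _.
have -> : r = 1 * r * 1 + 0 by rewrite mul1r mulr1 addr0.
by apply: gen_idealD; [exists (sbasis R a), (sbasis R b) | apply: gen_ideal0].
Qed.

(** The enveloping algebra is spanned by the words in the generators. *)
Lemma Uenv_ind (P : U -> Prop) :
  P 1 -> (forall (a : C) u w, P u -> P w -> P (a *: u + w)) ->
  (forall g u, P u -> P (ugen R g * u)) -> forall u, P u.
Proof.
move=> P1 PD PM u; have P0 : P 0 by rewrite -(addNr 1) -scaleN1r; apply: PD.
rewrite -(qreprK u) [qrepr u](malg_decomp (K := C)).
rewrite (linear_sum (qpi (@env_rel R))).
elim/big_rec: _ => [|m w _ Pw]; first exact: P0.
rewrite (linZ (qpi (@env_rel R))); apply: PD Pw.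
rewrite -(fmK m); elim: {m}(m : seq sgen) => [|g m IHm].
  have -> : << FMonom [::] >> = 1 :> stens R by rewrite -fmoneE.
  exact: P1.
have -> : FMonom (g :: m) = mmul (fmu g) (FMonom m) by rewrite /mmul /= fmmulE fmuE.
have -> : << mmul (fmu g) (FMonom m) >>
    = stens_in (sbasis R g) * << FMonom m >> :> stens R.
  by rewrite stens_in_basis malgM_def fgmulUU mulr1.
by rewrite /= qpi_mul; apply: PM.
Qed.

Section Modules.
Context (V : lmodType C) (act : U -> V -> V).
Hypothesis umod : is_umodule act.

Lemma act_is_linear u : linear (act u). Proof. by case: umod. Qed.

Definition act_linear u : {linear V -> V} :=
  HB.pack (act u) (GRing.isLinear.Build _ _ _ _ (act u) (act_is_linear u)).

Lemma act_bracket (a b : sgen) v :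
  act (ugen R a) (act (ugen R b) v) - act (ugen R b) (act (ugen R a) v)
  = \sum_g sbracket_gen R a b g *: act (ugen R g) v.
Proof.
have [_ actv _ actM] := umod.
pose L : {linear U -> V} :=
  HB.pack (act^~ v) (GRing.isLinear.Build _ _ _ _ (act^~ v) (actv v)).
apply: (etrans (f_equal2 (fun s t : V => s - t)
                  (esym (actM _ _ v)) (esym (actM _ _ v)))).
apply: (etrans (esym (linearB L _ _))).
apply: (etrans (congr1 L (ugen_bracket a b))).
apply: (etrans (linear_sum L _ _ _)).
by apply: eq_bigr => g _; apply: (linZ L).
Qed.

Lemma act_stable (W : V -> Prop) : subspace W ->
  (forall g v, W v -> W (act (ugen R g) v)) -> forall u v, W v -> W (act u v).
Proof.
have [_ actv act1 actM] := umod => sW Wg; elim/Uenv_ind => [|a u w IHu IHw|g u IHu] v Wv.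
- by rewrite act1.
- by rewrite (actv v a u w); case: sW => _; apply; [apply: IHu | apply: IHw].
- by rewrite actM; apply/Wg/IHu.
Qed.

Lemma act_intertwine (V' : lmodType C) (act' : U -> V' -> V')
    (phi : {linear V -> V'}) : is_umodule act' ->
  (forall g v, phi (act (ugen R g) v) = act' (ugen R g) (phi v)) ->
  forall u v, phi (act u v) = act' u (phi v).
Proof.
have [_ actv act1 actM] := umod => -[_ actv' act1' actM'] phig.
elim/Uenv_ind => [|a u w IHu IHw|g u IHu] v.
- by rewrite act1 act1'.
- by rewrite (actv v a u w) (actv' (phi v) a u w) linearP IHu IHw.
- by rewrite actM actM' phig IHu.
Qed.

End Modules.

Section Extension.
Context (V : lmodType C) (rho : sgen -> {linear V -> V}).
Hypothesis rho_bracket : forall (a b : sgen) v,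
  rho a (rho b v) - rho b (rho a v) = \sum_g sbracket_gen R a b g *: rho g v.

Let word (m : seq sgen) (v : V) : V := foldr (fun g w => rho g w) v m.

Let word_linear m : linear (word m).
Proof. by elim: m => //= g m IHm a v w /=; rewrite IHm linearP. Qed.

HB.instance Definition _ m :=
  GRing.isLinear.Build C V V *:%R (word m) (word_linear m).

Let tact (w : stens R) (v : V) : V :=
  lext (fun m : {fmonom sgen} => word m v) (w : {malg C[{fmonom sgen}]}).

Let tactDl v : linear (tact^~ v). Proof. exact: lext_is_linear. Qed.

Let tactDr w : linear (tact w).
Proof.
move=> a v v'; rewrite /tact /lext scaler_sumr -big_split; apply: eq_bigr => m _ /=.
by rewrite linearP scalerDr !scalerA mulrC.
Qed.

Let tactD (u w : stens R) v : tact (u + w) v = tact u v + tact w v.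
Proof. exact: linD (lext (fun m : {fmonom sgen} => word m v)) u w. Qed.

Let tactB (u w : stens R) v : tact (u - w) v = tact u v - tact w v.
Proof. exact: linearB (lext (fun m : {fmonom sgen} => word m v)) u w. Qed.

Let tact0r (w : stens R) : tact w 0 = 0.
Proof.
by rewrite /tact /lext big1 // => m _; rewrite (linear0 (word m)) scaler0.
Qed.

Let word_mul (m m' : {fmonom sgen}) v :
  word (mmul m m') v = word m (word m' v).
Proof. by rewrite fmM /word foldr_cat. Qed.

Let tactM (u w : stens R) v : tact (u * w) v = tact u (tact w v).
Proof.
rewrite /tact (malgME (u : {malg C[{fmonom sgen}]}) w).
set g := fun m : {fmonom sgen} => word m v.
rewrite (linear_sum (lext g)); apply: eq_bigr => m _.
rewrite (linear_sum (lext g)) (linear_sum (word m)) scaler_sumr.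
apply: eq_bigr => m' _; apply: (etrans (lextU g _ _)).
by rewrite (linZ (word m)) scalerA /g word_mul.
Qed.

Let lact s (v : V) : V := \sum_g s g *: rho g v.

Let tact_in s v : tact (stens_in s) v = lact s v.
Proof.
apply: (etrans (linear_sum (lext (fun m : {fmonom sgen} => word m v)) _ _ _)).
apply: eq_bigr => g _.
apply: (etrans (linZ (lext (fun m : {fmonom sgen} => word m v)) _ _)).
by apply: (etrans (congr1 _ (lext_basis _ _))); rewrite fmU.
Qed.

Let lact_bracket s t v :
  lact (sbracket s t) v = lact s (lact t v) - lact t (lact s v).
Proof.
have lact_sum (F : sgen -> schr R) :
    lact (\sum_a F a) v = \sum_a lact (F a) v.
  rewrite /lact exchange_big; apply: eq_bigr => g _ /=.
  by rewrite sum_ffunE scaler_suml.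
rewrite /sbracket lact_sum.
transitivity (\sum_a \sum_b (s a * t b) *: (rho a (rho b v) - rho b (rho a v))).
  apply: eq_bigr => a _; rewrite lact_sum; apply: eq_bigr => b _.
  rewrite rho_bracket /lact scaler_sumr; apply: eq_bigr => g _.
  by rewrite !ffunE scalerA.
under eq_bigr do under eq_bigr do rewrite scalerBr.
under eq_bigr do rewrite sumrB.
rewrite sumrB; congr (_ - _); last rewrite exchange_big; apply: eq_bigr => a _.
  rewrite (linear_sum (rho a)) scaler_sumr; apply: eq_bigr => b _.
  by rewrite (linZ (rho a)) scalerA.
rewrite (linear_sum (rho a)) scaler_sumr; apply: eq_bigr => b _.
by rewrite (linZ (rho a)) scalerA mulrC.
Qed.

Let tact_ideal (w : stens R) v : gen_ideal (@env_rel R) w -> tact w v = 0.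
Proof.
elim=> [|a r b {}w [s [t ->]] _ IHw].
  exact: linear0 (lext (fun m : {fmonom sgen} => word m v)).
rewrite tactD IHw addr0 !tactM; move: (tact b v) => v'.
apply: (etrans (congr1 (tact a) _) (tact0r a)).
have prod_in x y : tact (stens_in x * stens_in y) v' = lact x (lact y v').
  by apply: (etrans (tactM _ _ _)); rewrite tact_in (tact_in y).
apply: (etrans (tactB _ _ _)).
apply: (etrans (f_equal2 (fun u u' : V => u - u')
  (etrans (tactB _ _ _) (f_equal2 (fun u u' : V => u - u')
    (prod_in s t) (prod_in t s))) (tact_in _ _))).
by rewrite lact_bracket subrr.
Qed.

(** Operators satisfying the brackets of the generators extend, by composing
    words, to the tensor algebra, and from there to its quotient. *)
Lemma umodule_of_operators : exists act : U -> V -> V,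
  is_umodule act /\ forall g v, act (ugen R g) v = rho g v.
Proof.
pose act (u : U) v := tact (qrepr u) v.
have actE (w : stens R) v : act (qpi (@env_rel R) w) v = tact w v.
  apply/eqP; rewrite -subr_eq0; apply/eqP.
  rewrite /act -tactB.
  exact: tact_ideal (qreprPi _ _).
exists act; split; last first.
  move=> g v; apply: (etrans (actE _ _)); rewrite tact_in.
  exact: (sum_sbasis g (fun g => rho g v)).
split.
- by move=> u; apply: tactDr.
- move=> v a u w /=; rewrite -[u](qreprK u) -[w](qreprK w).
  rewrite -(qpi_linear a) !actE; exact: tactDl.
- move=> v; apply: (etrans (actE _ _)); apply: (etrans (lext_basis _ _)).
  by rewrite fm1.
- move=> u w v; rewrite -[u](qreprK u) -[w](qreprK w) -qpi_mul !actE.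
  exact: tactM.
Qed.

End Extension.
End Enveloping.

(** * Representations and modules over the enveloping algebra *)

Section Bridge.
Context (R : realType).
Local Notation C := R[i].
Local Notation U := (Uenv R).

Definition schr_op (V : lmodType C) (c : C) (q p f e h : {linear V -> V})
    (g : sgen) : {linear V -> V} :=
  match g with
  | Gf => f | Gq => q | Gh => h | Gz => c \*: idfun | Gp => p | Ge => e
  end.

Lemma schr_op_bracket (V : lmodType C) c (q p f e h : {linear V -> V}) :
  schr_rep c q p f e h -> forall (a b : sgen) v,
  schr_op c q p f e h a (schr_op c q p f e h b v)
  - schr_op c q p f e h b (schr_op c q p f e h a v)
  = \sum_g sbracket_gen R a b g *: schr_op c q p f e h g v.
Proof.
move=> rep a b v; set rho := schr_op c q p f e h.
pose lin (s : schr R) := \sum_g s g *: rho g v.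
have linB g : lin (sbasis R g) = rho g v by exact: (sum_sbasis g (fun g => rho g v)).
have linZ2 (k : C) s : lin (k *: s) = k *: lin s.
  by rewrite /lin scaler_sumr; apply: eq_bigr => g _; rewrite ffunE scalerA.
have linN1 s : lin (- s) = - lin s.
  by rewrite /lin -sumrN; apply: eq_bigr => g _; rewrite ffunE scaleNr.
have lin0 : lin 0 = 0 by rewrite /lin big1 // => g _; rewrite ffunE scale0r.
rewrite -/(lin _); case: a b => -[] /=; rewrite ?(linN1, linZ2, linB, lin0) /rho /=
  ?(linZ q, linZ p, linZ f, linZ e, linZ h);
  rewrite ?(rep_he rep, rep_hp rep, rep_hf rep, rep_hq rep, rep_eq rep, rep_ep rep,
    rep_ef rep, rep_pf rep, rep_fq rep, rep_pq rep);
  compare_coefficients (R[i] : numClosedFieldType) V; ring.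
Qed.

Section RepOfModule.
Context (V : lmodType C) (act : U -> V -> V) (umod : is_umodule act) (c : C).
Hypothesis act_z : forall v, act (ugen R Gz) v = c *: v.

Definition op (g : sgen) : {linear V -> V} := act_linear umod (ugen R g).

Lemma opE g v : op g v = act (ugen R g) v.
Proof. by []. Qed.

Lemma schr_rep_of_module : schr_rep c (op Gq) (op Gp) (op Gf) (op Ge) (op Gh).
Proof.
have sumB g v : \sum_g' sbasis R g g' *: act (ugen R g') v = op g v.
  exact: (sum_sbasis g (fun g => op g v)).
have sumZ (k : R[i]) g v :
    \sum_g' (k *: sbasis R g) g' *: act (ugen R g') v = k *: op g v.
  by rewrite -sumB scaler_sumr; apply: eq_bigr => g' _; rewrite ffunE scalerA.
have sumN (s : schr R) w v : \sum_g s g *: act (ugen R g) v = w ->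
    \sum_g (- s) g *: act (ugen R g) v = - w.
  by move=> <-; rewrite -sumrN; apply: eq_bigr => g _; rewrite ffunE scaleNr.
have sum0 v : \sum_g (0 : schr R) g *: act (ugen R g) v = 0.
  by rewrite big1 // => g _; rewrite ffunE scale0r.
have opB a b v w : \sum_g sbracket_gen R a b g *: act (ugen R g) v = w ->
    op a (op b v) = op b (op a v) + w.
  by move=> <-; rewrite -(act_bracket umod) addrC subrK.
split=> v.
- exact: (opB Gh Ge v _ (sumZ 2 Ge v)).
- exact: (opB Gh Gp v _ (sumB Gp v)).
- exact: (opB Gh Gf v _ (sumN _ _ _ (sumZ 2 Gf v))).
- exact: (opB Gh Gq v _ (sumN _ _ _ (sumB Gq v))).
- exact: (opB Ge Gq v _ (sumB Gp v)).
- exact: etrans (opB Ge Gp v 0 (sum0 v)) (addr0 _).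
- exact: (opB Ge Gf v _ (sumB Gh v)).
- exact: (opB Gp Gf v _ (sumN _ _ _ (sumB Gq v))).
- exact: etrans (opB Gf Gq v 0 (sum0 v)) (addr0 _).
- exact: (opB Gp Gq v _ (etrans (sumB Gz v) (act_z v))).
Qed.

End RepOfModule.
End Bridge.

(** * Simple weight modules *)

Section SimpleWeightModules.
Context (R : realType).
Local Notation U := (Uenv R).

Section Module.
Context (V : lmodType R[i]) (act : U -> V -> V) (umod : is_umodule act).
Local Notation op := (op umod).

(** Some component in the weight decomposition of a nonzero vector is nonzero. *)
Lemma common_eigenvector : (exists v : V, v != 0) -> is_weight act ->
  exists (v : V) (m c : R[i]), [/\ v != 0, op Gh v = m *: v & op Gz v = c *: v].
Proof.
move=> [v v0] weight; have [mu [[eig vE] _]] := weight v.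
have [[w mw0]|all0] := pselect (exists w, mu w != 0).
  by have [hw zw] := eig w; exists (mu w), w.1, w.2.
case/eqP: v0; rewrite vE big1 // => w _; apply/eqP; apply: contra_notT all0.
by exists w.
Qed.

Lemma submodule_of_stable (W : V -> Prop) : subspace W ->
  (forall g v, W v -> W (op g v)) -> is_usubmodule act W.
Proof.
by move=> sW Wg; have [W0 WD] := sW; split=> //; apply: (act_stable umod sW).
Qed.

(** The eigenspaces of the central element are submodules. *)
Lemma central_scalar v (c : R[i]) : is_simple act -> v != 0 ->
  op Gz v = c *: v -> forall w, op Gz w = c *: w.
Proof.
move=> [_ simple] v0 zv; pose W w := op Gz w = c *: w.
have sW : subspace W := subspace_eigen (op Gz) c.
have z_central g w : op Gz (op g w) = op g (op Gz w).
  apply/eqP; rewrite -subr_eq0; apply/eqP.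
  apply: (etrans (act_bracket umod Gz g w)).
  by rewrite big1 // => g' _; case: g; rewrite ffunE scale0r.
have [|W0|//] := simple W.
  apply: (submodule_of_stable sW) => g w Ww.
  exact: etrans (z_central g w) (etrans (congr1 (op g) Ww) (linZ (op g) c w)).
by move: v0; rewrite (W0 v zv) eqxx.
Qed.

Lemma irreducible_of_simple (c : R[i]) : is_simple act ->
  (forall v, op Gz v = c *: v) ->
  irreducible (op Gq) (op Gp) (op Gf) (op Ge) (op Gh).
Proof.
move=> [_ simple] zc W sW stab; apply: simple.
apply: (submodule_of_stable sW) => g v Wv; have [Wq Wp Wf We Wh] := stab v Wv.
have Wz : W (op Gz v) by rewrite zc; apply: subspaceZ.
by case: g; [exact: Wf | exact: Wq | exact: Wh | exact: Wz | exact: Wp | exact: We].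
Qed.

Lemma no_lowest_of_class : (forall lam, fin_dim (in_eigenspace act Gh lam)) ->
  ~ (exists lam, is_lowest_weight act lam) -> no_lowest_weight (op Gh).
Proof.
move=> fin nolow; split=> [|m v v0 hv]; first exact: fin.
apply: contrapT => none; apply: nolow; exists m; split; first by exists v.
move=> mu [w w0 hw] [[|k] muk]; first by apply/eqP; rewrite eq_sym -subr_eq0 muk.
case: none; exists k, w; split=> //; rewrite -muk opprB addrC subrK.
exact: hw.
Qed.

Lemma no_highest_of_class : (forall lam, fin_dim (in_eigenspace act Gh lam)) ->
  ~ (exists lam, is_highest_weight act lam) -> no_lowest_weight (\- op Gh).
Proof.
have negE m v : (\- op Gh) v = m *: v <-> op Gh v = (- m) *: v.
  by rewrite /= scaleNr; split=> [<-|->]; rewrite opprK.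
move=> fin nohigh; split=> [m|m v v0 /negE hv].
  have [d [b [Wb span]]] := fin (- m); exists d, b; split=> [k|v /negE/span//].
  by apply/negE; apply: Wb.
apply: contrapT => none; apply: nohigh; exists (- m); split; first by exists v.
move=> mu [w w0 hw] [[|k] muk]; first by apply/eqP; rewrite -subr_eq0 muk.
case: none; exists k, w; split=> //; apply/negE.
have -> : - (m - k.+1%:R) = mu by rewrite -muk; ring.
exact: hw.
Qed.

(** The parameter [x] obtained here is arbitrary in its class modulo the
    integers. *)
Lemma classN_seed : in_classN act -> exists (n : nat) (c x : R[i]) (v : int -> V),
  [/\ c != 0, forall w, op Gz w = c *: w,
      seed n c x (op Gq) (op Gp) (op Gf) (op Ge) (op Gh) v,
      forall i, v i != 0 & forall w, op Gp w = 0 -> w = 0].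
Proof.
move=> [simple [weight [fin [nontriv [nohigh nolow]]]]].
have [v0 [m [c [v0_neq0 hv0 zv0]]]] := common_eigenvector simple.1 weight.
have zc := central_scalar simple v0_neq0 zv0.
have rep := schr_rep_of_module umod zc.
have irr := irreducible_of_simple simple zc.
have [injq injp] := injective_qp rep irr (no_lowest_of_class fin nolow)
  (no_highest_of_class fin nohigh) v0_neq0 hv0 nontriv.
have c0 := central_charge_neq0 rep (fin m) v0_neq0 hv0 injq injp.
have [w [n [y [w0 hw Ew Hw Fw]]]] :=
  sl2_highest_vector rep c0 fin v0_neq0 hv0 injq injp.
have hw' : op Gh w = (n%:R - 2^-1 - (n%:R - 2^-1 - y)) *: w.
  by rewrite hw; congr (_ *: _); ring.
have [v sv vn0] := seed_exists rep c0 injq injp w0 hw' Ew Hw Fw.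
by exists n, c, (n%:R - 2^-1 - y), v.
Qed.

End Module.

Section StandardAction.
Context (n : nat) (B : lmodType R[i]) (bvec : int -> nat -> B).
Context (basis : free_basis n bvec) (c x : R[i]) (c_neq0 : c != 0).

Definition std_op : sgen -> {linear B -> B} :=
  schr_op c (bshift basis) (bp basis c x) (blower basis (2 * c)^-1)
    (be basis c x) (bh basis x).

Lemma standard_action_exists : exists act : U -> B -> B,
  is_umodule act /\ forall g u, act (ugen R g) u = std_op g u.
Proof.
apply: umodule_of_operators; apply: schr_op_bracket.
exact: (standard_rep basis x c_neq0).
Qed.

(** [Bq_formulas] for an abstract basis, which keeps the monoid algebra out of
    the calculations. *)
Definition standard_formulas (lam : R[i]) (act : U -> B -> B) : Prop :=
  forall (i : int) (j : nat), (j <= n)%N ->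
    let y : R[i] := i%:~R + x in
    act (ugen R Gq) (bvec i j) = bvec (i + 1) j /\
    act (ugen R Gf) (bvec i j) =
      (if (j < n)%N then bvec i j.+1
       else - \sum_(0 <= s < n.+1) ((2 * c) ^- (n.+1 - s) * 'C(n.+1, s)%:R)
                *: bvec (i + 2 * n.+1%:Z - 2 * s%:Z) s) /\
    act (ugen R Gz) (bvec i j) = c *: bvec i j /\
    act (ugen R Gh) (bvec i j) = (lam - y - 2 * j%:R) *: bvec i j /\
    act (ugen R Gp) (bvec i j) =
      - (j%:R *: bvec (i + 1) j.-1) + (c * y) *: bvec (i - 1) j /\
    act (ugen R Ge) (bvec i j) =
      (j%:R * (lam + 1 - y - j%:R)) *: bvec i j.-1
      + (2^-1 * c * y * (y - 1)) *: bvec (i - 2) j.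

Lemma btop_inv i : btop n bvec (2 * c)^-1 i
  = - \sum_(0 <= s < n.+1) ((2 * c) ^- (n.+1 - s) * 'C(n.+1, s)%:R)
        *: bvec (i + 2 * n.+1%:Z - 2 * s%:Z) s.
Proof. by rewrite /btop; under eq_bigr do rewrite exprVn. Qed.

Lemma standard_formulasP (act : U -> B -> B) : is_umodule act ->
  standard_formulas (n%:R - 2^-1) act
  <-> (forall g u, act (ugen R g) u = std_op g u).
Proof.
move=> umod; split=> [formulas g|std i j jn]; last first.
  have E g := std g (bvec i j); split; first exact: etrans (E Gq) (bshift_bvec _ _ _).
  split; first by apply: (etrans (E Gf)); rewrite -btop_inv; apply: blower_bvec.
  split; first exact: E Gz.
  split; first by apply: (etrans (E Gh)); apply: (bextE basis).
  split; first by apply: (etrans (E Gp)); apply: (bextE basis).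
  by apply: (etrans (E Ge)); apply: (bextE basis).
apply: (bvec_linear_ext basis (L1 := op umod g)) => i j jn.
have [fq [ff [fz [fh [fp fe]]]]] := formulas i j jn.
rewrite opE; case: g; rewrite /std_op /schr_op.
- by rewrite blower_bvec // btop_inv.
- by rewrite bshift_bvec.
- by rewrite /bh (bextE basis).
- by [].
- by rewrite /bp (bextE basis).
- by rewrite /be (bextE basis).
Qed.

Context (act : U -> B -> B) (umod : is_umodule act).
Hypothesis act_std : forall g u, act (ugen R g) u = std_op g u.

Section Realization.
Context (V : lmodType R[i]) (actV : U -> V -> V) (umodV : is_umodule actV).
Context (v : int -> V).
Local Notation op := (op umodV).
Hypotheses (simple : is_simple actV) (zc : forall w, op Gz w = c *: w).
Hypotheses (sv : seed n c x (op Gq) (op Gp) (op Gf) (op Ge) (op Gh) v).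
Hypothesis v_neq0 : forall i, v i != 0.

(** [v_(i, j) |-> f ^ j v_i] commutes with [U]; it is injective, and its
    image is a nonzero submodule of a simple module. *)
Lemma realization_iso : umodule_iso actV act.
Proof.
have rep := schr_rep_of_module umodV zc.
pose phi := family_map basis (op Gf) v.
have phi_act u w : phi (act u w) = actV u (phi w).
  apply: (act_intertwine umod umodV) => g {}w; rewrite act_std -opE.
  case: g; rewrite /std_op /schr_op.
  - exact: (family_map_f basis rep sv).
  - exact: (family_map_q basis rep sv).
  - exact: (family_map_h basis rep sv).
  - by rewrite zc; apply: (linZ phi).
  - exact: (family_map_p basis rep sv).
  - exact: (family_map_e basis rep sv).
have inj : injective phi := family_map_injective rep c_neq0 sv v_neq0.
have surj w : exists u, phi u = w.
  case: simple => _ /(_ (fun w => exists u, phi u = w)) [|all0|//].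
  - split=> [|a w1 w2 [u1 <-] [u2 <-]|u w1 [u1 <-]].
    + by exists 0; rewrite linear0.
    + by exists (a *: u1 + u2); rewrite linearP.
    + by exists (act u u1).
  - have /eqP : v 0 = 0.
      by apply: all0; exists (bvec 0 0); rewrite /phi family_map_bvec.
    by rewrite (negPf (v_neq0 0)).
have [psi psiK] := choice surj.
have psi_linear : linear psi by move=> a w1 w2; apply: inj; rewrite linearP !psiK.
pose Psi : {linear V -> B} :=
  HB.pack psi (GRing.isLinear.Build _ _ _ _ psi psi_linear).
exists Psi; first by exists phi => [w|u]; [exact: psiK | apply: inj; exact: psiK].
by move=> u w; apply: inj; rewrite phi_act -[Psi _]/(psi _) -[Psi w]/(psi w) !psiK.
Qed.

End Realization.

(** The charge is the scalar by which [z] acts, [n] the last power of [F] not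
    vanishing identically, and [x] is read off modulo the integers from the
    spectrum of [h]. *)
Lemma standard_iso_invariants (V : lmodType R[i]) (actV : U -> V -> V)
    (umodV : is_umodule actV) : umodule_iso actV act ->
  [/\ (exists2 w : V, w != 0 & forall w, op umodV Gz w = c *: w),
      forall w, iter n.+1 (sl2F c (op umodV Gq) (op umodV Gf)) w = 0,
      exists w, iter n (sl2F c (op umodV Gq) (op umodV Gf)) w != 0,
      (exists2 w, w != 0 & op umodV Gh w = (n%:R - 2^-1 - x) *: w)
    & forall m w, w != 0 -> op umodV Gh w = m *: w ->
        exists (i : int) (j : nat), m = n%:R - 2^-1 - (i%:~R + x) - 2 * j%:R].
Proof.
case=> phi [psi phiK psiK] phi_act; have inj := can_inj phiK.
have phi_op g w : phi (op umodV g w) = std_op g (phi w).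
  by rewrite opE phi_act act_std.
set F := sl2F _ _ _.
have phiF k w : phi (iter k F w)
    = iter k (sl2F c (bshift basis) (blower basis (2 * c)^-1)) (phi w).
  elim: k => // k IHk; rewrite !iterS -IHk; set w' := iter k F w.
  rewrite -[F w']/(op umodV Gf w' + (2 * c)^-1 *: op umodV Gq (op umodV Gq w')).
  by rewrite (linD phi) (linZ phi) !phi_op.
have neq0 u : u != 0 -> psi u != 0.
  by apply: contra_neq => psi0; rewrite -(psiK u) psi0 linear0.
have b0 := bvec_neq0 basis 0 (leq0n n).
split.
- exists (psi (bvec 0 0)); first exact: neq0.
  by move=> w; apply: inj; rewrite phi_op (linZ phi).
- by move=> w; apply: inj; rewrite phiF standard_F_nilpotent linear0.
- exists (psi (bvec 0 0)); have := standard_F_nonzero basis c.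
  by apply: contra_neq => Fn; rewrite -(psiK (bvec 0 0)) -phiF Fn linear0.
- exists (psi (bvec 0 0)); first exact: neq0.
  apply: inj; rewrite phi_op (linZ phi) psiK /std_op /schr_op /bh (bextE basis) //.
  by congr (_ *: _); rewrite mulr0 subr0 add0r.
- move=> m w w0 hw; apply: (standard_weights (basis := basis) (u := phi w)).
  + by apply: contra_neq w0 => phi0; apply: inj; rewrite phi0 linear0.
  + by rewrite -(linZ phi) -hw phi_op.
Qed.

End StandardAction.
End SimpleWeightModules.

(** * Classification *)

Section Classification.
Context (R : realType).
Local Notation U := (Uenv R).

Lemma malg_free_basis n : free_basis n (@Bvec R n).
Proof.
exists (fun (V : lmodType R[i]) (g : int -> nat -> V) =>
  (lext (fun k : int * 'I_n.+1 => g k.1 k.2) : {linear Bspace R n -> V})).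
  move=> V g i j jn; apply: (etrans (lext_basis _ _)).
  by rewrite /= inordK.
move=> u; pose key (k : int * 'I_n.+1) : int * nat := (k.1, val k.2).
exists (map key (msupp (u : {malg R[i][(int * 'I_n.+1)%type]}))).
exists (fun l => (u : {malg R[i][(int * 'I_n.+1)%type]})@_(l.1, inord l.2)).
split.
- by rewrite map_inj_uniq ?fset_uniq // => -[i j] [i' j'] [-> /val_inj ->].
- by move=> l /mapP[k _ ->] /=; rewrite -ltnS.
- rewrite big_map; apply: (etrans (malg_decomp (K := R[i]) _)).
  by apply: eq_bigr => -[i j] _; rewrite /Bvec /= inord_val.
Qed.

Lemma seed_shift (V : lmodType R[i]) n (c x : R[i]) (q p f e h : {linear V -> V})
    (v : int -> V) (s : int) :
  seed n c x q p f e h v ->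
  seed n c (x - s%:~R) q p f e h (fun i => v (i - s)).
Proof.
have shift (i : int) : i%:~R + (x - s%:~R) = (i - s)%:~R + x.
  by rewrite rmorphB /= addrA addrAC.
case=> sq sp se sh sF; split=> i; rewrite ?shift //.
- by rewrite sq; congr v; ring.
- by rewrite sp; congr (_ *: v _); ring.
- by rewrite se; congr (_ *: v _); ring.
Qed.

Lemma Re_intr (m : int) : complex.Re (m%:~R : R[i]) = m%:~R.
Proof. by rewrite -[m]intz raddfMz /= mulrzz. Qed.

Lemma Re_shift (x : R[i]) : exists s : int, 0 <= complex.Re (x - s%:~R) < 1.
Proof.
exists (Num.floor (complex.Re x)); rewrite raddfB /= Re_intr subr_ge0.
by have := floor_itv (complex.Re x); rewrite intrD -ltrBlDl.
Qed.

Lemma Re_fundamental (x y : R[i]) (m : int) : 0 <= complex.Re x < 1 ->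
  0 <= complex.Re y < 1 -> x - y = m%:~R -> x = y.
Proof.
move=> /andP[x0 x1] /andP[y0 y1] xy; suff m0 : m = 0.
  by apply/eqP; rewrite -subr_eq0 xy m0.
have Rem : complex.Re x - complex.Re y = m%:~R by rewrite -Re_intr -xy raddfB.
have m_lt1 : m < 1.
  by rewrite -(ltr_int R) -Rem ltrBlDr (lt_le_trans x1) // lerDl.
have m_gt1 : -1 < m.
  by rewrite -(ltr_int R) -Rem ltrBrDl rmorphN1 -ltrBrDr opprK (lt_le_trans y1) // lerDr.
by lia.
Qed.

End Classification.

Theorem theorem5 (R : realType) :
  (forall (n : nat) (lam c x : R[i]), Bq_params n lam c x ->
     exists! act : Uenv R -> Bspace R n -> Bspace R n,
       is_umodule act /\ Bq_formulas lam c x act) /\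
  (forall (V : lmodType R[i]) (actV : Uenv R -> V -> V),
     is_umodule actV -> in_classN actV ->
     exists! t : R[i] * R[i] * R[i],
       exists n : nat,
         Bq_params n t.1.1 t.1.2 t.2 /\
         exists act : Uenv R -> Bspace R n -> Bspace R n,
           [/\ is_umodule act, Bq_formulas t.1.1 t.1.2 t.2 act
             & umodule_iso actV act]).
Proof.
split=> [n lam c x [-> c0 _ _] | V actV umodV classV].
  have basis := malg_free_basis R n.
  have [act [umod std]] := standard_action_exists basis x c0.
  exists act; split.
    by split=> //; apply/(standard_formulasP basis c x umod).
  move=> act' [umod' /(standard_formulasP basis c x umod') std'].
  apply/funext => u; apply/funext => w.
  apply: (act_intertwine umod (phi := idfun) umod') => g {}w.
  exact: etrans (std g w) (esym (std' g w)).
have [n [c [x [v [c0 zc sv vn0 injp]]]]] := classN_seed umodV classV.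
have [s Re01] := Re_shift x.
have sv' := seed_shift s sv; set x' := x - s%:~R in sv' Re01.
have params : Bq_params n (n%:R - 2^-1) c x'.
  (* [x' = 0] would give [p v'_0 = 0]. *)
  split=> //; apply: contraNneq (vn0 (0 - s)) => x0.
  by apply/eqP/injp; rewrite (seed_p sv' 0) x0 addr0 mulr0 scale0r.
have basis := malg_free_basis R n.
have [act [umod std]] := standard_action_exists basis x' c0.
have iso : umodule_iso actV act.
  apply: (realization_iso (basis := basis) c0 umod std (umodV := umodV) _ zc sv').
    by case: classV.
  by move=> i; apply: vn0.
exists (n%:R - 2^-1, c, x'); split.
  exists n; split=> //; exists act; split=> //.
  exact/(standard_formulasP basis c x' umod).
move=> [[lam2 c2] x2] /= [n2 [[-> c20 x20 Re2]]].
case=> act2 [umod2 form2 iso2].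
have basis2 := malg_free_basis R n2.
have std2 := (standard_formulasP basis2 c2 x2 umod2).1 form2.
have [[w w0 zw] Fnil [u Fu] [h1 h10 hw1] wts] :=
  standard_iso_invariants std umodV iso.
have [[w2 w20 zw2] Fnil2 [u2 Fu2] _ wts2] :=
  standard_iso_invariants std2 umodV iso2.
have cE : c2 = c.
  apply/eqP; rewrite -subr_eq0; have /eqP : (c2 - c) *: w = 0.
    by rewrite scalerBl -zw -zw2 subrr.
  by rewrite scaler_eq0 (negPf w0) orbF.
rewrite cE in Fnil2 Fu2.
have nil_le (k l : nat) (F : {linear V -> V}) (y : V) :
    (forall y, iter k.+1 F y = 0) -> iter l F y != 0 -> (l <= k)%N.
  move=> nil; apply: contraNleq => /subnK <-.
  by rewrite iterD nil linear0.
have nE : n2 = n.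
  by apply/eqP; rewrite eqn_leq (nil_le _ _ _ _ Fnil Fu2) (nil_le _ _ _ _ Fnil2 Fu).
(* [n - 1/2 - x'] is a weight, hence one of those of the second module. *)
have [i [j xE]] := wts2 _ _ h10 hw1.
rewrite nE cE; congr (_, _, _).
apply: (@Re_fundamental _ _ _ (i + 2 * j%:Z)) => //.
rewrite !(rmorphD, rmorphM) /= -pmulrn; move: xE; rewrite nE => xE.
apply/eqP; rewrite -subr_eq0.
have -> : x' - x2 - (i%:~R + 2 * j%:R) = - ((n%:R - 2^-1 - x')
    - (n%:R - 2^-1 - (i%:~R + x2) - 2 * j%:R)) by ring.
by rewrite xE subrr oppr0.
Qed.
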